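(* Let $G$ be a monster model, $A\subset G$ small, and $H\lhd G$ an $A$-invariant normal subgroup of bounded index. Let $i\colon G\to G/G^{\infty}_A$ be the quotient map, with $G/G^{\infty}_A$ carrying the logic topology and $\mathrm{cl}$ the closure in it. Then \[ i^{-1}[\mathrm{cl}(i[H])]=\bigcap\{P\cdot Q : P,Q\subseteq G \text{ are } A\text{-definable thick sets and } P\supseteq H\cup Q\}. \] In particular $G^{00}_A=\bigcap\{P\cdot Q : P,Q\subseteq G \text{ are } A\text{-definable thick and } P\supseteq G^{\infty}_A\cup Q\}$.
   Context: $(G,\cdot,\ldots)$ is a group with additional first-order structure in a language $L$, assumed to be a monster model ($\overline{\kappa}$-saturated, $\overline{\kappa}$-strongly homogeneous, $\overline{\kappa}$ large); small/bounded means cardinality $<\overline{\kappa}$. $A$-invariant: fixed setwise by all automorphisms fixing $A$ pointwise. $G^{\infty}_A$ is the intersection of all $A$-invariant subgroups of bounded index; $G^{00}_A$ is the intersection of all subgroups type-definable (intersection of $A$-definable sets) over $A$ of bounded index. Logic topology on $G/G^{\infty}_A$: for a fixed small model $G'\prec G$ containing $A$, $X\subseteq G/G^{\infty}_A$ is closed iff $i^{-1}[X]$ is type-definable over $G'$. A subset $X\subseteq G$ is thick ($n$-thick) if $X=X^{-1}$ and for some $n\in\mathbb N$, for all $g_0,\ldots,g_{n-1}\in G$ (not necessarily distinct) there are $i<j<n$ with $g_i^{-1}g_j\in X$. *)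

(* Defs.v *)
From HB Require Import structures.
From mathcomp Require Import all_boot all_order.
From mathcomp Require Import all_classical topology.

Set Implicit Arguments.
Unset Strict Implicit.
Unset Printing Implicit Defensive.

Local Open Scope group_scope.
Local Open Scope card_scope.
Local Open Scope classical_set_scope.
Local Open Scope quotient_scope.

Record language := Language {
  fsym : Type; farity : fsym -> nat;
  rsym : Type; rarity : rsym -> nat }.

(* The free variables of [term L n] and [formula L n] are indexed by 'I_n;
   [All] binds the variable [ord0] and shifts the other ones. *)
Inductive term (L : language) (n : nat) : Type :=
| Var of 'I_n
| App (f : fsym L) of ('I_(farity f) -> term L n).

Inductive formula (L : language) (n : nat) : Type :=
| Eq of term L n & term L n
| Rel (r : rsym L) of ('I_(rarity r) -> term L n)
| Bot
| Imp of formula L n & formula L n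
| All of formula L n.+1.

Arguments Bot {L n}.

Record structure (L : language) (T : Type) := Structure {
  fint : forall f : fsym L, ('I_(farity f) -> T) -> T;
  rint : forall r : rsym L, ('I_(rarity r) -> T) -> Prop }.

Definition scons (T : Type) (n : nat) (x : T) (v : 'I_n -> T) : 'I_n.+1 -> T :=
  fun i => if unlift ord0 i is Some j then v j else x.

Lemma scons0 T n (x : T) (v : 'I_n -> T) : scons x v ord0 = x.
Proof. by rewrite /scons unlift_none. Qed.

Lemma sconsS T n (x : T) (v : 'I_n -> T) j : scons x v (lift ord0 j) = v j.
Proof. by rewrite /scons liftK. Qed.

Fixpoint eval L T (M : structure L T) n (v : 'I_n -> T) (t : term L n) : T :=
  match t with
  | Var i => v i
  | App f ts => fint M (fun i => eval M v (ts i))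
  end.

Fixpoint sat L T (M : structure L T) n (phi : formula L n) :
    ('I_n -> T) -> Prop :=
  match phi with
  | Eq s t => fun v => eval M v s = eval M v t
  | Rel r ts => fun v => rint M (fun i => eval M v (ts i))
  | Bot => fun=> False
  | Imp phi psi => fun v => sat M phi v -> sat M psi v
  | All phi => fun v => forall x, sat M phi (scons x v)
  end.

Definition definable L T (M : structure L T) (B X : set T) : Prop :=
  exists n (phi : formula L n.+1) (b : 'I_n -> T),
    (forall i, B (b i)) /\ X = [set x | sat M phi (scons x b)].

Definition type_definable L T (M : structure L T) (B X : set T) : Prop :=
  exists F : set (set T), F `<=` definable M B /\ X = \bigcap_(Y in F) Y.

Definition elementary_substructure L T (M : structure L T) (D : set T) : Prop :=
  exists N : structure L (set_type D),
    forall n (phi : formula L n) (v : 'I_n -> set_type D),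
      sat N phi v <-> sat M phi (fun i => set_val (v i)).

Definition automorphism L T (M : structure L T) (s : T -> T) : Prop :=
  [/\ bijective s,
      forall f v, s (fint M (f := f) v) = fint M (s \o v) &
      forall r v, rint M (r := r) (s \o v) <-> rint M v].

Definition aut_invariant L T (M : structure L T) (B X : set T) : Prop :=
  forall s, automorphism M s -> (forall b, B b -> s b = b) -> s @` X = X.

Definition partial_elementary L T (M : structure L T) (B : set T) (f : T -> T) :
    Prop :=
  forall n (phi : formula L n) (b : 'I_n -> T), (forall i, B (b i)) ->
    (sat M phi b <-> sat M phi (f \o b)).

(* The cardinal of the monster model is represented by a type [K] of that
   cardinality. *)
Definition card_lt T U (A : set T) (B : set U) : Prop :=
  A #<= B /\ ~ (B #<= A).

Definition small (K : Type) T (A : set T) : Prop := card_lt A [set: K].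

Definition strong_limit (K : Type) : Prop :=
  forall X : set K, small K X -> small K [set Y | Y `<=` X].

Definition large (L : language) (K : Type) : Prop :=
  [/\ small K [set: nat], small K [set: fsym L], small K [set: rsym L] &
      strong_limit K].

(* A type over B is given by the family of the B-definable sets which its
   formulas define. *)
Definition saturated (K : Type) L T (M : structure L T) : Prop :=
  forall B : set T, small K B ->
  forall p : set (set T), p `<=` definable M B -> finI p id ->
    \bigcap_(Y in p) Y !=set0.

Definition strongly_homogeneous (K : Type) L T (M : structure L T) : Prop :=
  forall B : set T, small K B ->
  forall f, partial_elementary M B f ->
  exists s, automorphism M s /\ forall b, B b -> s b = f b.

Definition monster (K : Type) L T (M : structure L T) : Prop :=
  [/\ large L K, saturated K M & strongly_homogeneous K M].

(* The language of (G, *, ...): the symbols of L and a binary function symbol,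
   [None], for the multiplication. *)
Definition group_language (L : language) : language := {|
  fsym := option (fsym L);
  farity := oapp (@farity L) 2;
  rsym := rsym L;
  rarity := @rarity L |}.

Definition group_structure L (G : groupType) (M : structure L G) :
    structure (group_language L) G := {|
  fint := fun f : fsym (group_language L) =>
    match f return ('I_(oapp (@farity L) 2 f) -> G) -> G with
    | Some f' => @fint L G M f'
    | None => fun v => v ord0 * v ord_max
    end;
  rint := @rint L G M |}.

Definition subgroup (G : groupType) (H : set G) : Prop := group_closed (mem H).

Definition normal_set (G : groupType) (H : set G) : Prop :=
  forall g x, H x -> H (x ^ g).

Definition left_coset (G : groupType) (H : set G) (g : G) : set G :=
  [set g * h | h in H].

Definition bounded_index (K : Type) (G : groupType) (H : set G) : Prop :=
  small K (range (left_coset H)).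

Definition set_mul (G : groupType) (P Q : set G) : set G :=
  [set x * y | x in P & y in Q].

Definition thick (G : groupType) (X : set G) : Prop :=
  [set x^-1 | x in X] = X /\
  exists n, forall g : 'I_n -> G, exists i j : 'I_n,
    (i < j)%N /\ X ((g i)^-1 * g j).

Section Components.
Variables (K : Type) (L : language) (G : groupType) (M : structure L G).
Variable A : set G.

Definition Ginfty : set G :=
  \bigcap_(H in [set H | [/\ subgroup H, aut_invariant M A H & bounded_index K H]])
    H.

Definition G00 : set G :=
  \bigcap_(H in [set H |
      [/\ subgroup H, type_definable M A H & bounded_index K H]]) H.

Lemma subgroup_Ginfty : subgroup Ginfty.
Proof.
split=> [|x y]; first by apply/mem_set => H [[/set_mem]].
move=> /set_mem Hx /set_mem Hy; apply/mem_set => H HH.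
have [[_ Hdiv] _ _] := HH.
by apply/set_mem/Hdiv; apply/mem_set; [apply: Hx|apply: Hy].
Qed.

Definition coset_rel : rel G := fun x y => `[< Ginfty (x^-1 * y) >].

Lemma coset_rel_refl : reflexive coset_rel.
Proof.
by move=> x; apply/asboolP; rewrite mulVg; exact/set_mem/(subgroup_Ginfty).1.
Qed.

Lemma coset_rel_sym : symmetric coset_rel.
Proof.
suff sym x y : coset_rel x y -> coset_rel y x.
  by move=> x y; apply/idP/idP; apply: sym.
move=> /asboolP Hxy; apply/asboolP/set_mem.
have := group_closedV subgroup_Ginfty (mem_set Hxy).
by rewrite invgM invgK.
Qed.

Lemma coset_rel_trans : transitive coset_rel.
Proof.
move=> y x z /asboolP Hxy /asboolP Hyz; apply/asboolP/set_mem.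
have := group_closedM subgroup_Ginfty (mem_set Hxy) (mem_set Hyz).
by rewrite mulgA mulgK.
Qed.

Canonical coset_equiv :=
  EquivRel coset_rel coset_rel_refl coset_rel_sym coset_rel_trans.

End Components.

Section Renaming.
Variables (L : language) (T : Type) (M : structure L T).

Fixpoint trename n m (f : 'I_n -> 'I_m) (t : term L n) : term L m :=
  match t with
  | Var i => Var L (f i)
  | App s ts => App (fun i => trename f (ts i))
  end.

Definition ren_up n m (f : 'I_n -> 'I_m) : 'I_n.+1 -> 'I_m.+1 :=
  scons ord0 (fun i => lift ord0 (f i)).

Fixpoint rename n (phi : formula L n) : forall m, ('I_n -> 'I_m) -> formula L m :=
  match phi with
  | Eq s t => fun m f => Eq (trename f s) (trename f t)
  | Rel r ts => fun m f => Rel (fun i => trename f (ts i))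
  | Bot => fun m f => Bot
  | Imp phi psi => fun m f => Imp (rename phi f) (rename psi f)
  | All phi => fun m f => All (rename phi (ren_up f))
  end.

Lemma eval_rename n m (f : 'I_n -> 'I_m) (v : 'I_m -> T) t :
  eval M v (trename f t) = eval M (v \o f) t.
Proof.
by elim: t => //= s ts IH; congr fint; apply/funext => i; rewrite IH.
Qed.

Lemma scons_ren_up n m (f : 'I_n -> 'I_m) (v : 'I_m -> T) x :
  scons x v \o ren_up f = scons x (v \o f).
Proof.
apply/funext => i; rewrite /ren_up /=.
by case: (unliftP ord0 i) => [j|] ->; rewrite ?sconsS ?scons0.
Qed.

Lemma sat_rename n (phi : formula L n) m (f : 'I_n -> 'I_m) (v : 'I_m -> T) :
  sat M (rename phi f) v <-> sat M phi (v \o f).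
Proof.
elim: phi m f v => {n} [n s t|n r ts|n|n phi IHp psi IHq|n phi IH] m f v //=.
- by rewrite !eval_rename.
- have -> // : (fun i => eval M v (trename f (ts i))) =
               (fun i => eval M (v \o f) (ts i)).
  by apply/funext => i; rewrite eval_rename.
- by rewrite IHp IHq.
- by split=> h x; have := h x; rewrite IH scons_ren_up.
Qed.

Lemma definable0 B : definable M B set0.
Proof.
have v0 : 'I_0 -> T by case.
by exists 0, Bot, v0; split=> [[]|].
Qed.

Lemma definableU B X Y :
  definable M B X -> definable M B Y -> definable M B (X `|` Y).
Proof.
move=> [n [phi [a [Ba ->]]]] [m [psi [b [Bb ->]]]].
pose c (i : 'I_(n + m)) := match fintype.split i with inl j => a j | inr j => b j end.
pose f := scons (ord0 : 'I_(n + m).+1) (fun i => lift ord0 (lshift m i)).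
pose g := scons (ord0 : 'I_(n + m).+1) (fun i => lift ord0 (rshift n i)).
have fE x : scons x c \o f = scons x a.
  apply/funext => i; rewrite /f /=.
  case: (unliftP ord0 i) => [j|] ->; rewrite ?scons0 // !sconsS /c.
  by rewrite (unsplitK (inl _ j)).
have gE x : scons x c \o g = scons x b.
  apply/funext => i; rewrite /g /=.
  case: (unliftP ord0 i) => [j|] ->; rewrite ?scons0 // !sconsS /c.
  by rewrite (unsplitK (inr _ j)).
exists (n + m), (Imp (Imp (rename phi f) Bot) (rename psi g)), c.
split; first by rewrite /c => i; case: fintype.split.
apply/seteqP; split=> x /=; rewrite !sat_rename fE gE.
  by case=> // ? /(_ _).
by move=> h; case: (pselect (sat M phi (scons x a))) => [|/h]; [left|right].
Qed.

Lemma type_definable0 B : type_definable M B set0.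
Proof.
exists [set set0]; split; last by rewrite bigcap_set1.
by move=> _ ->; exact: definable0.
Qed.

Lemma type_definableU B X Y :
  type_definable M B X -> type_definable M B Y ->
  type_definable M B (X `|` Y).
Proof.
move=> [F [FB ->]] [F' [FB' ->]].
exists [set U `|` V | U in F & V in F']; split.
  by move=> _ [U /FB ? [V /FB' ? <-]]; exact: definableU.
apply/seteqP; split=> x /=.
  by case=> Fx _ [U FU [V FV <-]]; [left|right]; apply: Fx.
move=> h; case: (pselect ((\bigcap_(U in F) U) x)) => [|nF]; first by left.
have [U [FU nU]] : exists U, F U /\ ~ U x.
  apply: contrapT => nex; apply: nF => U FU; apply: contrapT => nU.
  by apply: nex; exists U.
right=> V FV; have UV : (U `|` V) x by apply: h; exists U => //; exists V.
by case: UV.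
Qed.

Lemma type_definable_bigcap B (I : Type) (X : I -> set T) :
  (forall i, type_definable M B (X i)) -> type_definable M B (\bigcap_i X i).
Proof.
move=> /choice[F FP]; exists (\bigcup_i F i); split.
  by move=> Y [i _ FY]; apply: (FP i).1.
apply/seteqP; split=> x h.
  by move=> Y [i _ FY]; have := h i Logic.I; rewrite (FP i).2; apply.
by move=> i _; rewrite (FP i).2 => Y FY; apply: h; exists i.
Qed.

End Renaming.

(* The quotient G / G^infty_A.  The set [D], which does not occur in the
   underlying type, is the small model used to define the logic topology. *)
Definition logic_quotient (K : Type) (L : language) (G : groupType)
    (M : structure L G) (A D : set G) : Type :=
  {eq_quot (coset_rel K M A)}.

Section LogicTopology.
Variables (K : Type) (L : language) (G : groupType) (M : structure L G).
Variables (A D : set G).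

Local Notation logic_quotient := (logic_quotient K M A D).

HB.instance Definition _ := Choice.copy logic_quotient
  {eq_quot (coset_rel K M A)}.

Definition coset_map (x : G) : logic_quotient :=
  \pi_{eq_quot (coset_rel K M A)} x.

Definition logic_open (X : set logic_quotient) : Prop :=
  type_definable M D (coset_map @^-1` (~` X)).

Lemma logic_openT : logic_open setT.
Proof. by rewrite /logic_open setCT preimage_set0; exact: type_definable0. Qed.

Lemma logic_openI : setI_closed logic_open.
Proof.
by move=> X Y hX hY; rewrite /logic_open setCI preimage_setU;
  exact: type_definableU.
Qed.

Lemma logic_open_bigcup (I : Type) (f : I -> set logic_quotient) :
  (forall i, logic_open (f i)) -> logic_open (\bigcup_i f i).
Proof.
by move=> h; rewrite /logic_open setC_bigcup preimage_bigcap;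
  exact: type_definable_bigcap.
Qed.

HB.instance Definition _ := isOpenTopological.Build logic_quotient
  logic_openT logic_openI logic_open_bigcup.

Lemma logic_closedE (X : set logic_quotient) :
  closed X <-> type_definable M D (coset_map @^-1` X).
Proof.
by rewrite -openC -[X in type_definable _ _ (_ @^-1` X)]setCK; split.
Qed.

Lemma coset_mapE x y : coset_map x = coset_map y <-> Ginfty K M A (x^-1 * y).
Proof. by split=> [/eqmodP/asboolP //|h]; apply/eqmodP/asboolP. Qed.

End LogicTopology.

(* Main.v *)
(* Let [Theta] be the intersection of all A-definable thick sets, and write
   [R] for the right-hand side of the first equality.

   A non-thick symmetric set is avoided by the quotients of arbitrarily long
   families, two members of which lie in the same coset of a given subgroup of
   bounded index.  Hence [Theta] is contained in every A-invariant subgroup of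
   bounded index, and every symmetric A-definable set containing H is thick.
   By saturation [R] is therefore contained in [hull H * Theta], where [hull H]
   is the intersection of the A-definable sets containing H.

   The key point is that [hull H] is contained in [H * Q] for every A-definable
   thick Q: H is covered by finitely many translates [w Q] with w in H, so
   every type over A of an element of [hull H] is realised in one of these
   translates, and [H * Q] is A-invariant.  Since H is normal, this gives
   [R = \bigcap_Q (H * Q)], which is a union of cosets of H.  If F is
   type-definable, contains H and is stable under right multiplication by
   [Theta], then for x in [R] all the sets [F :&: x Q] are nonempty, so by
   saturation x lies in [F * Theta = F].  Thus [R] is the least closed set
   containing H.

   For the second equality, this minimality shows that [R] is a subgroup when
   H = G^infty_A, and G^infty_A has bounded index because there are few
   A-definable sets. *)

Require Import Defs.
From HB Require Import structures.
From mathcomp Require Import all_boot all_order.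
From mathcomp Require Import all_classical topology.

Set Implicit Arguments.
Unset Strict Implicit.
Unset Printing Implicit Defensive.

Local Open Scope group_scope.
Local Open Scope card_scope.
Local Open Scope classical_set_scope.

(** * Comparison of cardinals and small sets *)

(** Zorn's lemma on graphs of partial injections: a maximal graph is total on one side, since points
    missed on both sides would form a new pair. *)
Lemma injective_total (T U : Type) :
  (exists f : T -> U, injective f) \/ (exists f : U -> T, injective f).
Proof.
pose P : set (set (T * U)) :=
  [set C | forall a b, C a -> C b -> a.1 = b.1 <-> a.2 = b.2].
have [F FP Ftot|C [PC Cmax]] := @Zorn_bigcup _ P.
  move=> a b [X FX Xa] [Y FY Yb].
  by have [XY|YX] := Ftot _ _ FX FY;
    [apply: (FP _ FY) => //; apply: XY|apply: (FP _ FX) => //; apply: YX].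
have [dom|/existsNP[x0 nx0]] := pselect (forall x, exists y, C (x, y)).
  left; have [f Cf] := choice dom; exists f => x y fxy.
  exact: ((PC _ _ (Cf x) (Cf y)).2 fxy).
have [ran|/existsNP[y0 ny0]] := pselect (forall y, exists x, C (x, y)).
  right; have [f Cf] := choice ran; exists f => x y fxy.
  exact: ((PC _ _ (Cf x) (Cf y)).1 fxy).
case: (Cmax (C `|` [set (x0, y0)])).
  split; first by move=> a; left.
  by move=> /(_ (x0, y0) (or_intror erefl)) Cx; apply: nx0; exists y0.
move=> [a1 a2] [b1 b2] /= [Ca|[-> ->]] [Cb|[-> ->]] //; first exact: (PC _ _ Ca Cb).
- by split=> e; [case: nx0; exists a2; rewrite -e|case: ny0; exists a1; rewrite -e].
- by split=> e; [case: nx0; exists b2; rewrite e|case: ny0; exists b1; rewrite e].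
Qed.

Lemma injective_card_le T U (A : set T) (B : set U) (f : T -> U) :
  {in A &, injective f} -> f @` A `<=` B -> A #<= B.
Proof.
move=> injf fAB; have := inj_card_eq injf.
by rewrite card_eq_le => /andP[_ /card_le_trans]; apply; exact: subset_card_le.
Qed.

Lemma card_leT_injective (T U : Type) :
  [set: T] #<= [set: U] <-> exists f : T -> U, injective f.
Proof.
split=> [/card_leP[f]|[f injf]]; last first.
  by apply: (@injective_card_le _ _ _ _ f) => // x y _ _; exact: injf.
exists (fun x => val (f (SigSub (mem_set (I : [set: T] x))))) => x y /val_inj.
by move=> /(inj (mem_set I) (mem_set I)) [].
Qed.

Lemma card_le_of_factor (I T U : Type) (f : I -> T) (g : I -> U) :
  (forall x y, f x = f y -> g x = g y) -> range g #<= range f.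
Proof.
move=> fg; have [[i0]|noI] := pselect (inhabited I); last first.
  rewrite (_ : range g = set0) ?card_ge0 // -subset0 => u [i _ _].
  by apply: noI.
have /choice[h hP] t : exists i, range f t -> f i = t.
  by have [[i _ fi]|nt] := pselect (range f t); [exists i|exists i0].
apply: card_le_trans (card_image_le (g \o h) (range f)).
apply: subset_card_le => _ [i _ <-]; exists (f i); first by exists i.
by apply: fg; apply: hP; exists i.
Qed.

Section Small.
Variable K : Type.

Lemma small_card_le T U (A : set T) (B : set U) :
  A #<= B -> small K B -> small K A.
Proof.
move=> AB [BK nKB]; split; first exact: card_le_trans BK.
by move=> KA; apply: nKB; exact: card_le_trans AB.
Qed.

Lemma small_set_type T (A : set T) : small K [set: A] <-> small K A.
Proof.
have /card_eqPle[AA' A'A] := card_setT A.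
by split; apply: small_card_le.
Qed.

Lemma small_injective (T U : Type) (f : T -> U) :
  injective f -> small K [set: U] -> small K [set: T].
Proof. by move=> injf; apply: small_card_le; apply/card_leT_injective; exists f. Qed.

Lemma small_image T U (f : T -> U) (A : set T) : small K A -> small K (f @` A).
Proof. exact/small_card_le/card_image_le. Qed.

Lemma small_subset T (A B : set T) : A `<=` B -> small K B -> small K A.
Proof. by move=> /subset_card_le/small_card_le. Qed.

Hypothesis limK : strong_limit K.

Lemma small_powerset (U : Type) : small K [set: U] -> small K [set: set U].
Proof.
move=> sU; have /card_leT_injective[f injf] := sU.1.
have sfU := limK (small_image f sU).
apply: small_card_le sfU; apply: (@injective_card_le _ _ _ _ (image^~ f)).
  by move=> X Y _ _ eXY; apply/funext => x; rewrite -(image_inj injf) eXY image_inj.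
by move=> _ [X _ <-] x [u _ <-]; exists u.
Qed.

(** [U + V] embeds into [W + W] for the larger summand [W], and [W + W] into the double powerset of
    [W], which is small for a strong limit. *)
Lemma small_sum (U V : Type) :
  small K [set: U] -> small K [set: V] -> small K [set: U + V].
Proof.
(* The extra member [set0] marks the right summand. *)
pose e W (x : W + W) : set (set W) :=
  match x with inl w => [set [set w]] | inr w => [set [set w]; set0] end.
have inje W : injective (@e W).
  have ne (w : W) : [set w] <> set0 by move=> /seteqP[/(_ w erefl)].
  have inj1 (w w' : W) : [set w] = [set w'] -> w = w'.
    by move=> /seteqP[/(_ w erefl)].
  case=> w [] w' /seteqP[/= s s'].
  - by rewrite (inj1 _ _ (s _ erefl)).
  - by have /ne := esym (s' _ (or_intror erefl)).
  - by have /ne := esym (s _ (or_intror erefl)).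
  - by case: (s _ (or_introl erefl)) => [/inj1->|/ne].
have sWW W : small K [set: W] -> small K [set: W + W].
  by move=> sW; apply: (small_injective (@inje W)); do 2!apply: small_powerset.
move=> sU sV; have [[f injf]|[f injf]] := injective_total U V.
  apply: (@small_injective _ _ (fun x : U + V => match x with inl u => inl (f u)
    | inr v => inr v end : V + V) _ (sWW _ sV)).
  by move=> [u|v] [u'|v'] // [] => [/injf|] ->.
apply: (@small_injective _ _ (fun x : U + V => match x with inl u => inl u
    | inr v => inr (f v) end : U + U) _ (sWW _ sU)).
by move=> [u|v] [u'|v'] // [] => [|/injf] ->.
Qed.

Lemma small_prod (U V : Type) :
  small K [set: U] -> small K [set: V] -> small K [set: U * V].
Proof.
move=> sU sV.
pose e (x : U * V) : set (U + V) := [set inl x.1; inr x.2].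
apply: (@small_injective _ _ e _ (small_powerset (small_sum sU sV))).
move=> [u v] [u' v'] /seteqP[s _].
have /= [[->]|//] := s (inl u) (or_introl erefl).
by have /= [//|[->]] := s (inr v) (or_intror erefl).
Qed.

Lemma small_setU T (A B : set T) : small K A -> small K B -> small K (A `|` B).
Proof.
move=> /small_set_type sA /small_set_type sB.
apply: small_subset (small_image (fun x : A + B =>
  match x with inl a => set_val a | inr b => set_val b end) (small_sum sA sB)).
by move=> x [xA|xB]; [exists (inl (SigSub (mem_set xA)))
                     |exists (inr (SigSub (mem_set xB)))].
Qed.

Hypothesis natK : small K [set: nat].

Lemma small_countType (U : countType) : small K [set: U].
Proof. exact: small_injective (pcan_inj pickleK) natK. Qed.

Lemma small_mem (T : eqType) (s : seq T) : small K [set` s].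
Proof.
case: s => [|x s]; last first.
  apply: small_subset (small_image (nth x (x :: s)) natK) => y /= ys.
  by exists (index y (x :: s)); rewrite ?nth_index.
by apply: small_card_le natK; rewrite set_nil; exact: card_ge0.
Qed.

End Small.

(* Definable relations in arbitrarily many variables *)
#[local] Hint Resolve iff_refl : core.

Definition update (I : eqType) T (v : I -> T) (k : I) (x : T) : I -> T :=
  fun i => if i == k then x else v i.

Definition assign I J T (v : J -> T) (g : I -> J + T) : I -> T :=
  fun i => match g i with inl j => v j | inr b => b end.

Section DefinableRelations.
Variables (L : language) (T : Type) (M : structure L T).

(** Variables are indexed by any type, possibly infinite, and [f] tells which variable or parameter
    stands at each position of [phi]. Types in infinitely many variables can thus be stated. *)
Definition definable_rel (B : set T) (I : Type) (R : (I -> T) -> Prop) : Prop :=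
  exists n (phi : formula L n) (f : 'I_n -> I + T),
    (forall j b, f j = inr b -> B b) /\
    forall v, R v <-> sat M phi (assign v f).

Lemma definable_rel_sub B B' I (R : (I -> T) -> Prop) :
  B `<=` B' -> definable_rel B R -> definable_rel B' R.
Proof. by move=> BB' [n [phi [f [fB Rphi]]]]; exists n, phi, f; split=> // j b /fB/BB'. Qed.

Lemma definable_rel_ext B I (R R' : (I -> T) -> Prop) :
  (forall v, R v <-> R' v) -> definable_rel B R -> definable_rel B R'.
Proof.
move=> RR' [n [phi [f [fB Rphi]]]]; exists n, phi, f; split=> // v.
by rewrite -RR'.
Qed.

Lemma definable_rel_bot B I : definable_rel B (fun _ : I -> T => False).
Proof. by exists 0, Bot, (fun j : 'I_0 => match notF (ltn_ord j) with end); split=> // -[]. Qed.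

Lemma definable_rel_imp B I (R R' : (I -> T) -> Prop) :
  definable_rel B R -> definable_rel B R' -> definable_rel B (fun v => R v -> R' v).
Proof.
move=> [n [phi [f [fB Rphi]]]] [m [psi [g [gB Rpsi]]]].
exists (n + m), (Imp (rename phi (@lshift n m)) (rename psi (@rshift n m))).
exists (fun j => match fintype.split j with inl i => f i | inr i => g i end).
split=> [j b|v /=]; first by case: fintype.split => i; [apply: fB|apply: gB].
rewrite !sat_rename Rphi Rpsi.
have -> : assign v (fun j => match fintype.split j with inl i => f i | inr i => g i end)
    \o @lshift n m = assign v f.
  by apply/funext => i; rewrite /assign /= (unsplitK (inl _ i)).
have -> // : assign v (fun j => match fintype.split j with inl i => f i | inr i => g i end)
    \o @rshift n m = assign v g.
by apply/funext => i; rewrite /assign /= (unsplitK (inr _ i)).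
Qed.

Lemma definable_rel_not B I (R : (I -> T) -> Prop) :
  definable_rel B R -> definable_rel B (fun v => ~ R v).
Proof. by move=> dR; apply: definable_rel_imp => //; exact: definable_rel_bot. Qed.

Lemma definable_rel_and B I (R R' : (I -> T) -> Prop) :
  definable_rel B R -> definable_rel B R' -> definable_rel B (fun v => R v /\ R' v).
Proof.
move=> dR dR'.
apply: definable_rel_ext (definable_rel_not (definable_rel_imp dR (definable_rel_not dR'))) => v.
by rewrite not_implyP notK.
Qed.

Lemma definable_rel_ex B (I : eqType) (k : I) (R : (I -> T) -> Prop) :
  definable_rel B R -> definable_rel B (fun v => exists x, R (update v k x)).
Proof.
move=> [n [phi [f [fB Rphi]]]].
(* Positions holding the variable [k] go to the bound variable, all others are shifted; the
   existential is written as a negated universal. *)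
pose g j := if f j is inl i then if i == k then ord0 else lift ord0 j else lift ord0 j.
exists n, (Imp (All (Imp (rename phi g) Bot)) Bot), f; split=> // v.
rewrite -[sat _ _ _]/(~ forall x, ~ sat M (rename phi g) (scons x (assign v f))).
rewrite -existsNP.
suff E x : R (update v k x) <-> ~ ~ sat M (rename phi g) (scons x (assign v f)).
  by split=> -[x /E Rx]; exists x.
rewrite notK sat_rename Rphi.
have -> // : scons x (assign v f) \o g = assign (update v k x) f.
apply/funext => j; rewrite /= /g /assign /update.
by case fj: (f j) => [i|b]; [case: ifP|]; rewrite ?scons0 // sconsS fj.
Qed.

Lemma definable_rel_assign B I J (g : I -> J + T) (R : (I -> T) -> Prop) :
  (forall i b, g i = inr b -> B b) ->
  definable_rel B R -> definable_rel B (fun v => R (assign v g)).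
Proof.
move=> gB [n [phi [f [fB Rphi]]]].
exists n, phi, (fun j => match f j with inl i => g i | inr b => inr b end).
split=> [j b|v]; first by case fj: (f j) => [i|c]; [apply: gB|case=> <-; apply: fB fj].
rewrite Rphi.
have -> // : assign (assign v g) f =
    assign v (fun j => match f j with inl i => g i | inr b => inr b end).
by apply/funext => j; rewrite /assign; case: (f j).
Qed.

Lemma definable_rel_const B (I : eqType) (k : I) b (R : (I -> T) -> Prop) :
  B b -> definable_rel B R -> definable_rel B (fun v => R (update v k b)).
Proof.
move=> Bb /(@definable_rel_assign _ _ _ (fun i => if i == k then inr b else inl i)) dR.
apply: definable_rel_ext (dR _) => [v|i c]; last by case: ifP => // _ [<-].
have -> // : assign v (fun i => if i == k then inr b else inl i) = update v k b.
by apply/funext => i; rewrite /assign /update; case: ifP.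
Qed.

Lemma definable_rel_definable B X I (k : I) :
  definable M B X -> definable_rel B (fun v => X (v k)).
Proof.
move=> [n [phi [b [Bb ->]]]].
exists n.+1, phi, (scons (inl k) (fun j => inr (b j))); split=> [j c|v].
  by case: (unliftP ord0 j) => [i|] ->; rewrite ?scons0 // sconsS => -[<-].
have -> // : assign v (scons (inl k) (fun j => inr (b j))) = scons (v k) b.
apply/funext => j; rewrite /assign.
by case: (unliftP ord0 j) => [i|] ->; rewrite ?scons0 // !sconsS.
Qed.

Lemma definable_rel_eq B I (i j : I) : definable_rel B (fun v => v i = v j).
Proof.
exists 2, (Eq (Var L ord0) (Var L ord_max)).
by exists (fun k : 'I_2 => if k == ord0 then inl i else inl j); split=> // k b; case: ifP.
Qed.

Lemma definable_of_rel B I (R : (I -> T) -> Prop) :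
  definable_rel B R -> definable M B [set x | R (fun=> x)].
Proof.
move=> [n [phi [f [fB Rphi]]]].
(* [definable] wants a parameter at each of the [n] positions, so [b0] fills those where [f] has a
   variable. If [B] is empty, every position holds a variable. *)
have [[b0 Bb0]|noB] := pselect (B !=set0).
  pose g j := if f j is inr b then lift ord0 j else ord0.
  exists n, (rename phi g), (fun j => if f j is inr b then b else b0); split.
    by move=> j; case fj: (f j) => [//|b]; apply: fB fj.
  apply/seteqP; split=> x /=; rewrite Rphi sat_rename;
    have -> // : assign (fun=> x) f =
      scons x (fun j => match f j with inl _ => b0 | inr b => b end) \o g;
    by apply/funext => j; rewrite /assign /= /g; case fj: (f j); rewrite ?scons0 // sconsS fj.
exists 0, (rename phi (fun=> ord0)), (fun j : 'I_0 => match notF (ltn_ord j) with end).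
split=> [[]//|].
apply/seteqP; split=> x /=; rewrite Rphi sat_rename;
  set v := assign _ _; set v' := (_ \o _); have -> // : v = v';
  apply/funext => j; rewrite /v /v' /assign /= scons0; case fj: (f j) => [//|b];
  by case: noB; exists b; apply: fB fj.
Qed.

Lemma definable_rel_support B (I : eqType) (R : (I -> T) -> Prop) :
  definable_rel B R ->
  exists s : seq I, forall v v', {in s, v =1 v'} -> R v <-> R v'.
Proof.
move=> [n [phi [f [_ Rphi]]]].
exists (pmap (fun j => if f j is inl i then Some i else None) (enum 'I_n)).
move=> v v' vv'; rewrite !Rphi.
have -> // : assign v f = assign v' f.
apply/funext => j; rewrite /assign; case fj: (f j) => [i|//]; apply: vv'.
by rewrite mem_pmap; apply/mapP; exists j; rewrite ?mem_enum // fj.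
Qed.

Lemma definable_rel_ex_seq B (I : eqType) (s : seq I) (R : (I -> T) -> Prop) :
  definable_rel B R ->
  definable_rel B (fun v => exists v', (forall i, i \notin s -> v' i = v i) /\ R v').
Proof.
move=> dR; elim: s => [|k s IH].
  apply: definable_rel_ext dR => v; split=> [Rv|[v' [vv' Rv']]]; first by exists v.
  by have <- : v' = v by apply/funext => i; apply: vv'.
apply: definable_rel_ext (definable_rel_ex k IH) => v.
split=> [[x [v' [v'E Rv']]]|[v' [v'E Rv']]].
  exists v'; split=> // i; rewrite inE negb_or => /andP[ik /v'E ->].
  by rewrite /update (negPf ik).
exists (v' k), v'; split=> // i si; rewrite /update; case: eqP => [->//|/eqP ik].
by apply: v'E; rewrite inE negb_or ik.
Qed.

Lemma definable_update B (I : eqType) (v0 : I -> T) (k : I) (R : (I -> T) -> Prop) :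
  definable_rel B R ->
  definable M (B `|` range v0) [set x | R (update v0 k x)].
Proof.
pose g i : unit + T := if i == k then inl tt else inr (v0 i).
have gB i b : g i = inr b -> (B `|` range v0) b.
  by rewrite /g; case: ifP => // _ [<-]; right; exists i.
move=> /(definable_rel_sub (@subsetUl _ B (range v0))).
move=> /(definable_rel_assign gB)/definable_of_rel.
congr definable; apply/funext => x; congr R; apply/funext => i.
by rewrite /assign /g /update; case: ifP.
Qed.

Lemma definable_sub B B' X : B `<=` B' -> definable M B X -> definable M B' X.
Proof. by move=> BB' [n [phi [b [Bb ->]]]]; exists n, phi, b; split=> // i; apply: BB'. Qed.

Lemma definableC B X : definable M B X -> definable M B (~` X).
Proof.
move=> /(@definable_rel_definable _ _ unit tt)/definable_rel_not/definable_of_rel.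
by [].
Qed.

Lemma definableI B X Y : definable M B X -> definable M B Y -> definable M B (X `&` Y).
Proof.
move=> dX dY; rewrite -[_ `&` _]setCK setCI.
by apply/definableC/definableU; exact: definableC.
Qed.

Lemma definableT B : definable M B setT.
Proof. by rewrite -setC0; apply/definableC/definable0. Qed.

End DefinableRelations.

(** * Saturation in one variable and in many *)

Section Saturation.
Variables (K : Type) (L : language) (T : choiceType) (M : structure L T).
Hypothesis satM : saturated K M.

(** By directedness a nonempty member of [F] lies below any finite subfamily, which gives the finite
    intersection property. *)
Lemma saturated_directed B (F : set (set T)) :
  small K B -> F `<=` definable M B -> F !=set0 ->
  (forall X Y, F X -> F Y -> exists2 Z, F Z & Z `<=` X `&` Y) ->
  (forall X, F X -> X !=set0) ->
  \bigcap_(Y in F) Y !=set0.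
Proof.
move=> sB FB [X0 FX0] Fdir Fn0; apply: (satM sB FB) => s sF.
have {}sF X : X \in finmap.enum_fset s -> F X by move=> Xs; exact/set_mem/sF.
suff [Z FZ sZ] : exists2 Z, F Z & forall X, X \in finmap.enum_fset s -> Z `<=` X.
  by have [x Zx] := Fn0 _ FZ; exists x => X /= /sZ; apply.
elim: (finmap.enum_fset s) sF => [|X s' IH] sF; first by exists X0.
have [|Y FY sY] := IH; first by move=> X' sX'; apply: sF; rewrite inE sX' orbT.
have [|Z FZ ZXY] := Fdir X Y _ FY; first by apply: sF; rewrite inE eqxx.
exists Z => // X'; rewrite inE => /orP[/eqP ->|/sY YX'] z /ZXY[] // _.
exact: YX'.
Qed.

Hypotheses (limK : strong_limit K) (t0 : T).

(** Zorn's lemma on partial assignments [C] such that each member of [F] holds at some extension of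
    [C]; one-variable saturation shows that a maximal [C] is total. *)
Lemma saturated_rel (I : eqType) B (F : set ((I -> T) -> Prop)) :
  small K B -> small K [set: I] ->
  (forall R, F R -> definable_rel M B R) -> F !=set0 ->
  (forall R R', F R -> F R' -> exists2 R'', F R'' & forall v, R'' v -> R v /\ R' v) ->
  (forall R, F R -> exists v, R v) ->
  exists v, forall R, F R -> R v.
Proof.
move=> sB sI FB [R0 FR0] Fdir Fsat.
pose extends (v : I -> T) (C : set (I * T)) := forall i x, C (i, x) -> v i = x.
pose P : set (set (I * T)) :=
  [set C | forall R, F R -> exists2 v, extends v C & R v].
have [E EP Etot|C [PC Cmax]] := @Zorn_bigcup _ P.
  move=> R FR; have [E0|/set0P[C0 EC0]] := eqVneq E set0.
    by rewrite E0 bigcup_set0; have [v Rv] := Fsat _ FR; exists v.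
  (* [R] depends on finitely many variables, so a single member [C1] of the chain already fixes
     every value that the union [D] gives them. *)
  have [s Rs] := definable_rel_support (FB _ FR).
  pose D := \bigcup_(C in E) C.
  have Dfun i x y : D (i, x) -> D (i, y) -> x = y.
    move=> [C EC Cx] [C' EC' Cy].
    have [C'' EC'' [C''x C''y]] : exists2 C'', E C'' & C'' (i, x) /\ C'' (i, y).
      have [CC'|CC'] := Etot _ _ EC EC'; [exists C'|exists C] => //; split=> //; exact: CC'.
    by have [v vC'' _] := EP _ EC'' _ FR; rewrite -(vC'' _ _ C''x) (vC'' _ _ C''y).
  have [C1 EC1 C1s] : exists2 C1, E C1 &
      forall i, i \in s -> forall x, D (i, x) -> C1 (i, x).
    elim: {Rs} s => [|i s [C1 EC1 C1s]]; first by exists C0.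
    have [[x Dx]|nD] := pselect (exists x, D (i, x)); last first.
      exists C1 => // j; rewrite inE => /orP[/eqP ->|/C1s//] x Dx.
      by case: nD; exists x.
    have [C2 EC2 C2x] := Dx.
    have [C3 EC3 [C13 C23]] : exists2 C3, E C3 & C1 `<=` C3 /\ C2 `<=` C3.
      by have [CC'|CC'] := Etot _ _ EC1 EC2; [exists C2|exists C1] => //; split.
    exists C3 => // j; rewrite inE => /orP[/eqP ->|js] y Dy; last exact/C13/C1s.
    by rewrite -(Dfun _ _ _ Dx Dy); exact: C23.
  have [v vC1 Rv] := EP _ EC1 _ FR.
  exists (fun i => xget (v i) [set x | D (i, x)]).
    by move=> i x Dx; case: xgetP => [y _ /Dfun|/(_ x)//]; apply.
  apply/(Rs _ v) => // i si; case: xgetP => // y _ Dy.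
  by rewrite (vC1 _ _ (C1s _ si _ Dy)).
have Cfun i x y : C (i, x) -> C (i, y) -> x = y.
  by have [v vC _] := PC _ FR0; move=> /vC <- /vC.
have [Ctot|/existsNP[i0 ni0]] := pselect (forall i, exists x, C (i, x)).
  have [v Cv] := choice Ctot; exists v => R FR.
  have [v' v'C] := PC _ FR.
  by have -> // : v' = v by apply/funext => i; apply/v'C.
pose v0 i := xget t0 [set x | C (i, x)].
have v0C i x : C (i, x) -> v0 i = x.
  by move=> Cx; rewrite /v0; case: xgetP => [y _ /Cfun|/(_ x)//]; apply.
(* [X R] collects the values at [i0] compatible with [C] and [R]; a value common to all [R] extends
   [C] against maximality. *)
pose X (R : (I -> T) -> Prop) := [set x | exists v, [/\ extends v C, v i0 = x & R v]].
have [x Xx] : \bigcap_(Y in [set X R | R in F]) Y !=set0.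
  apply: (@saturated_directed (B `|` range v0)).
  - by apply: small_setU => //; exact: small_image.
  - move=> _ [R FR <-].
    have [s Rs] := definable_rel_support (FB _ FR).
    (* Only the unassigned variables in the support of [R] are quantified, and they are finitely
       many; [v0] supplies the others as parameters. *)
    pose ks := [seq i <- s | (i != i0) && `[< forall x, ~ C (i, x) >]].
    have := definable_update v0 i0 (definable_rel_ex_seq ks (FB _ FR)).
    congr definable; apply/seteqP; split=> x.
      move=> [v' [v'E Rv']]; exists v'; split=> //.
        move=> i y Ciy; rewrite v'E.
          rewrite /update; case: eqP => [ii0|_]; last exact: v0C.
          by case: ni0; exists y; rewrite -ii0.
        rewrite mem_filter; apply/negP => /andP[/andP[_ /asboolP nC] _].
        exact: nC Ciy.
      by rewrite v'E /update ?eqxx // mem_filter eqxx.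
    move=> [v [vC vi0 Rv]].
    exists (fun i => if i \in ks then v i else update v0 i0 x i); split.
      by move=> i /negPf ->.
    apply/(Rs _ v) => // i si; case: ifPn => //.
    rewrite mem_filter si andbT negb_and negbK /update.
    case: eqP => [->//|_ /= /asboolPn/existsNP[y /contrapT Ciy]].
    by rewrite (v0C _ _ Ciy) (vC _ _ Ciy).
  - by exists (X R0), R0.
  - move=> _ _ [R FR <-] [R' FR' <-]; have [R'' FR'' RR'] := Fdir _ _ FR FR'.
    exists (X R''); first by exists R''.
    by move=> x [v [vC vi0 /RR'[]]]; split; exists v.
  - move=> _ [R FR <-]; have [v vC Rv] := PC _ FR.
    by exists (v i0), v.
case: (Cmax (C `|` [set (i0, x)])).
  split; first by move=> a; left.
  by move=> /(_ (i0, x) (or_intror erefl)) Cx; apply: ni0; exists x.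
move=> R FR; have [v [vC vi0 Rv]] : X R x by apply: Xx; exists R.
by exists v => // i y [/vC//|[-> ->]].
Qed.

End Saturation.

(** * Ramsey's theorem and thick sets *)

(** Double induction: the tail splits into the entries [e]-related to the head and the others, so
    length [N1 + N2 + 1] suffices. *)
Lemma ramsey (T : eqType) (e : rel T) n m : exists N, forall s : seq T, (N <= size s)%N ->
  exists2 t, subseq t s &
    size t = n /\ pairwise e t \/ size t = m /\ pairwise (fun x y => ~~ e x y) t.
Proof.
elim: n m => [|n IHn] m; first by exists 0 => s _; exists [::]; [exact: sub0seq|left].
elim: m => [|m [N2 IHm]]; first by exists 0 => s _; exists [::]; [exact: sub0seq|right].
have [N1 {}IHn] := IHn m.+1.
exists (N1 + N2).+1 => -[|x s] //=; rewrite ltnS -(count_predC (e x)) => Ns.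
have sub a t : subseq t (seq.filter a s) -> subseq t (x :: s).
  move=> /subseq_trans; apply; exact: subseq_trans (filter_subseq _ _) (subseq_cons _ _).
have cons_sub a t : subseq t (seq.filter a s) -> subseq (x :: t) (x :: s) && all a t.
  move=> ta; rewrite /= eqxx (subseq_trans ta (filter_subseq _ _)).
  by apply/allP => y /(mem_subseq ta); rewrite mem_filter => /andP[].
have [N1s|N1s] := leqP N1 (count (e x) s).
  have [|t ts [[st et]|[st et]]] := IHn (seq.filter (e x) s); first by rewrite size_filter.
    have /andP[ts' xt] := cons_sub _ _ ts.
    by exists (x :: t) => //; left; rewrite /= st xt et.
  by exists t; [exact: sub ts|right].
have [|t ts [[st et]|[st et]]] := IHm (seq.filter (predC (e x)) s).
- rewrite size_filter -(leq_add2l N1); apply: leq_trans Ns _.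
  by rewrite leq_add2r ltnW.
- by exists t; [exact: sub ts|left].
have /andP[ts' xt] := cons_sub _ _ ts.
by exists (x :: t) => //; right; rewrite /= st et andbT.
Qed.

Section ThickSets.
Variable G : groupType.
Implicit Types (X Y S : set G) (s : seq G).

(** A scattered sequence is a counterexample to thickness of its length; thickness of a symmetric
    set bounds these lengths. *)
Definition scattered X : seq G -> bool := pairwise (fun x y => `[< ~ X (x^-1 * y) >]).

Lemma thickP X : thick X <-> (forall x, X x -> X x^-1) /\
  exists n, forall s, (n <= size s)%N -> ~ scattered X s.
Proof.
split=> [[Xinv [n Xn]]|[Xinv [n Xn]]].
  split; first by move=> x Xx; rewrite -Xinv; exists x.
  exists n => s ns /(pairwiseP 1) ss.
  have [i [j [ij Xij]]] := Xn (fun i : 'I_n => nth 1 s i).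
  have /asboolP := ss i j (leq_trans (ltn_ord i) ns) (leq_trans (ltn_ord j) ns) ij.
  exact.
split.
  apply/seteqP; split=> [_ [x /Xinv Xx <-] //|x /Xinv Xx].
  by exists x^-1 => //; rewrite invgK.
exists n => g; apply: contrapT => ng.
apply: (Xn (mkseq (fun i => if insub i is Some k then g k else 1) n)).
  by rewrite size_mkseq.
apply/(pairwiseP 1) => i j; rewrite !inE size_mkseq => iltn jltn ij.
rewrite !nth_mkseq // !insubT /= => Xij.
by apply: ng; exists (Ordinal iltn), (Ordinal jltn).
Qed.

Lemma thick_inv X x : thick X -> X x -> X x^-1.
Proof. by move=> /thickP[Xinv _]; exact: Xinv. Qed.

Lemma thick1 X : thick X -> X 1.
Proof. by move=> [_ [n /(_ (fun=> 1))[i [j [_]]]]]; rewrite mulVg. Qed.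

Lemma thickT : thick [set: G].
Proof. by apply/thickP; split=> //; exists 2 => -[|x [|y s]] //= _ /andP[/andP[/asboolP]]. Qed.

(** By Ramsey, a long sequence scattered for the intersection has a long subsequence that is
    scattered for [X], or one whose quotients all lie in [X] and hence avoid [Y]. *)
Lemma thickI X Y : thick X -> thick Y -> thick (X `&` Y).
Proof.
move=> /thickP[Xinv [n Xn]] /thickP[Yinv [m Ym]]; apply/thickP; split.
  by move=> x [/Xinv ? /Yinv ?].
have [N HN] := ramsey (fun x y => `[< ~ X (x^-1 * y) >]) n m.
exists N => s /HN[t ts [[st]|[st]]]; first by move=> et _; case: (Xn t _ et); rewrite st.
move=> et ss; apply: (Ym t); first by rewrite st.
have := subseq_pairwise ts ss; move: et => /[swap]; rewrite /scattered.
elim: t {ts st} => //= x t IH /andP[/allP XYxt XYt] /andP[/allP Xxt Xt].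
rewrite IH // andbT; apply/allP => y yt; apply/asboolP => Yxy.
have /asboolP := XYxt _ yt; apply; split=> //.
by have /asboolPn/contrapT := Xxt _ yt.
Qed.

Lemma scattered_cons X x s : (forall y, X y -> X y^-1) ->
  scattered X s -> (forall y, y \in s -> ~ X (y^-1 * x)) -> scattered X (x :: s).
Proof.
move=> Xinv ss xs; rewrite /scattered /= -/(scattered X s) ss andbT.
apply/allP => y ys; apply/asboolP => /Xinv.
by rewrite invgM invgK; exact: xs.
Qed.

(** Any point of [S] not covered by a scattered sequence prolongs it, so without a finite cover
    arbitrarily long ones would exist. *)
Lemma thick_cover X S : thick X -> exists s, (forall x, x \in s -> S x) /\
  forall x, S x -> exists2 g, g \in s & X (g^-1 * x).
Proof.
move=> /thickP[Xinv [n Xn]]; apply: contrapT => ncov.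
have [s [ns _ ss]] : exists s, [/\ (n <= size s)%N, forall x, x \in s -> S x & scattered X s].
  elim: {Xn} n => [|n [s [ns sS ss]]]; first by exists [::].
  have [x [Sx xs]] : exists x, S x /\ forall y, y \in s -> ~ X (y^-1 * x).
    apply: contrapT => nx; apply: ncov; exists s; split=> // x Sx.
    apply: contrapT => ng; apply: nx; exists x; split=> // y ys Xyx.
    by apply: ng; exists y.
  exists (x :: s); split=> //; last exact: scattered_cons.
  by move=> y; rewrite inE => /orP[/eqP ->|/sS].
exact: Xn ss.
Qed.

Lemma not_thick_scattered X n : (forall x, X x -> X x^-1) -> ~ thick X ->
  exists2 s, (n <= size s)%N & scattered X s.
Proof.
move=> Xinv nX; apply: contrapT => ns; apply: nX; apply/thickP; split=> //.
by exists n => s sn ss; apply: ns; exists s.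
Qed.

End ThickSets.

(** * Subgroups and their cosets *)

Section Subgroups.
Variables (G : groupType) (H : set G).
Hypothesis gH : subgroup H.

Lemma subgroup1 : H 1. Proof. exact/set_mem/gH.1. Qed.

Lemma subgroupM x y : H x -> H y -> H (x * y).
Proof. by move=> Hx Hy; apply/set_mem/(group_closedM gH); exact: mem_set. Qed.

Lemma subgroupV x : H x -> H x^-1.
Proof. by move=> Hx; apply/set_mem/(group_closedV gH); exact: mem_set. Qed.

Lemma left_coset_eq x y : left_coset H x = left_coset H y <-> H (x^-1 * y).
Proof.
split=> [exy|Hxy].
  have [h Hh <-] : left_coset H x y; last by rewrite mulKg.
  by rewrite exy; exists 1; rewrite ?mulg1 //; exact: subgroup1.
apply/seteqP; split=> _ [h Hh <-].
  exists ((x^-1 * y)^-1 * h); last by rewrite invgM invgK -mulgA mulVKg.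
  exact/subgroupM/Hh/subgroupV.
exists (x^-1 * y * h); last by rewrite -mulgA mulVKg.
exact: subgroupM.
Qed.

End Subgroups.

Lemma subgroupP (G : groupType) (H : set G) : H 1 ->
  (forall x y, H x -> H y -> H (x * y)) -> (forall x, H x -> H x^-1) -> subgroup H.
Proof.
move=> H1 HM HV; split=> [|x y /set_mem Hx /set_mem Hy]; apply/mem_set => //.
exact/HM/HV.
Qed.

(** * Definability in the group language and automorphisms *)

Section GroupDefinability.
Variables (L : language) (G : groupType) (M0 : structure L G).
Local Notation M := (group_structure M0).
Implicit Types (B X Y : set G).

Lemma definable_rel_mul B I (i j k : I) :
  definable_rel M B (fun v : I -> G => v i * v j = v k).
Proof.
pose ts (l : 'I_(farity (None : Defs.fsym (group_language L)))) :=
  Var (group_language L) (widen_ord (leqnSn 2) l).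
exists 3, (Eq (App ts) (Var _ ord_max)).
exists (fun l : 'I_3 => inl (nth k [:: i; j; k] l)).
by split.
Qed.

(** Multiplication is the only group symbol, so the quotient is expressed as the solution [z] of
    [v i * z = v j]. *)
Lemma definable_rel_div B X I (i j : I) : definable M B X ->
  definable_rel M B (fun v => X ((v i)^-1 * v j)).
Proof.
move=> dX.
have := definable_rel_and (definable_rel_mul B 0%N 2%N 1%N) (definable_rel_definable 2%N dX).
move=> /(definable_rel_ex 2%N).
move=> /(@definable_rel_assign _ _ _ _ _ I (fun n => inl (if n == 0%N then i else j))).
move=> /(_ (fun n b e => match e with end)).
apply: definable_rel_ext => v; rewrite /update /assign /=; split.
  by move=> [z [<-]]; rewrite mulKg.
by move=> Xij; exists ((v i)^-1 * v j); rewrite mulVKg.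
Qed.

Lemma definable_rel_all B I (J : eqType) (s : seq J) (R : J -> (I -> G) -> Prop) :
  (forall j, definable_rel M B (R j)) ->
  definable_rel M B (fun v => forall j, j \in s -> R j v).
Proof.
move=> dR; elim: s => [|j s IH].
  apply: definable_rel_ext (definable_rel_not (definable_rel_bot M B I)) => v.
  by split=> [_ j|_ []].
apply: definable_rel_ext (definable_rel_and (dR j) IH) => v; split.
  by move=> [Rj Rs] j'; rewrite inE => /orP[/eqP ->|/Rs].
by move=> Rs; split=> [|j' j's]; apply: Rs; rewrite inE ?eqxx ?j's ?orbT.
Qed.

Lemma definable_set_mul B X Y :
  definable M B X -> definable M B Y -> definable M B (set_mul X Y).
Proof.
move=> dX dY.
have := definable_rel_and (definable_rel_mul B 1%N 2%N 0%N)
  (definable_rel_and (definable_rel_definable 1%N dX) (definable_rel_definable 2%N dY)).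
move=> /(definable_rel_ex 2%N)/(definable_rel_ex 1%N)/definable_of_rel.
congr definable; apply/seteqP; split=> z; rewrite /update /=.
  by move=> [x [y [<- [Xx Yy]]]]; exists x => //; exists y.
by move=> [x Xx [y Yy <-]]; exists x, y.
Qed.

Lemma definable_setV B X : definable M B X -> definable M B [set x | X x^-1].
Proof.
move=> dX.
(* Variable 2 is the identity, defined as the idempotent, and variable 1 is the inverse of variable
   0. *)
have := definable_rel_and (definable_rel_mul B 2%N 2%N 2%N)
  (definable_rel_and (definable_rel_mul B 0%N 1%N 2%N) (definable_rel_definable 1%N dX)).
move=> /(definable_rel_ex 2%N)/(definable_rel_ex 1%N)/definable_of_rel.
congr definable; apply/seteqP; split=> z; rewrite /update /=.
  move=> [x [y [yy [zx]]]].
  have y1 : y = 1 by apply: (mulgI y); rewrite yy mulg1.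
  by have -> : z^-1 = x by apply: (mulgI z); rewrite mulgV zx y1.
by move=> Xz; exists z^-1, 1; rewrite mulg1 mulgV.
Qed.

Lemma definable_lcoset B X b : B b -> definable M B X -> definable M B [set x | X (b^-1 * x)].
Proof.
by move=> Bb /(@definable_rel_div _ _ _ 0%N 1%N)/(definable_rel_const 0%N Bb)/definable_of_rel.
Qed.

Lemma definable_div B X b : B b -> definable M B X -> definable M B [set x | X (x^-1 * b)].
Proof.
by move=> Bb /(@definable_rel_div _ _ _ 0%N 1%N)/(definable_rel_const 1%N Bb)/definable_of_rel.
Qed.

Lemma definable_lcosets B X (s : seq G) : (forall b, b \in s -> B b) ->
  definable M B X -> definable M B [set x | exists2 b, b \in s & X (b^-1 * x)].
Proof.
elim: s => [|b s IH] sB dX.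
  by rewrite (_ : [set x | _] = set0); [exact: definable0|rewrite -subset0 => x []].
have -> : [set x | exists2 b', b' \in b :: s & X (b'^-1 * x)] =
    [set x | X (b^-1 * x)] `|` [set x | exists2 b', b' \in s & X (b'^-1 * x)].
  apply/seteqP; split=> x /=.
    by move=> [b']; rewrite inE => /orP[/eqP ->|b's]; [left|right; exists b'].
  by case=> [|[b' b's]] Xx; [exists b|exists b'] => //; rewrite inE ?eqxx ?b's ?orbT.
apply: definableU.
  by apply: definable_lcoset => //; apply: sB; rewrite inE eqxx.
by apply: IH => // b' b's; apply: sB; rewrite inE b's orbT.
Qed.

Section Automorphisms.
Variable s : G -> G.
Hypothesis aut_s : automorphism M s.

Lemma aut_mul x y : s (x * y) = s x * s y.
Proof.
have [_ aut_f _] := aut_s.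
exact: (aut_f (None : Defs.fsym (group_language L))
  (fun i => if i == ord0 :> 'I_2 then x else y)).
Qed.

Lemma aut_eval n (t : term (group_language L) n) v : s (Defs.eval M v t) = Defs.eval M (s \o v) t.
Proof.
have [_ aut_f _] := aut_s; elim: t => // f ts IH.
rewrite [Defs.eval M v _]/(fint M (fun i => Defs.eval M v (ts i))) aut_f.
rewrite [RHS]/(fint M (fun i => Defs.eval M (s \o v) (ts i))).
by congr fint; apply/funext => i; exact: IH.
Qed.

Lemma aut_sat n (phi : formula (group_language L) n) v : sat M phi (s \o v) <-> sat M phi v.
Proof.
have [[s' sK s'K] _ aut_r] := aut_s.
elim: phi v => {n} [n t u|n r ts|n|n phi IHp psi IHq|n phi IH] v //.
- rewrite /= -!aut_eval.
  by split=> [/(can_inj sK)|/= ->].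
- rewrite -[sat M (Rel ts) v]/(rint M (fun i => Defs.eval M v (ts i))) -aut_r /=.
  have -> // : (fun i => Defs.eval M (s \o v) (ts i)) = s \o (fun i => Defs.eval M v (ts i)).
  by apply/funext => i; rewrite /= aut_eval.
- by rewrite /= IHp IHq.
have scons_comp x : scons (s x) (s \o v) = s \o scons x v.
  by apply/funext => i; case: (unliftP ord0 i) => [j|] ->; rewrite /= ?scons0 // !sconsS.
split=> phiv x.
  by apply/(IH (scons x v)); rewrite -scons_comp; exact: phiv.
by rewrite -[x]s'K scons_comp; apply/IH; exact: phiv.
Qed.

Lemma aut_definable B X x : (forall b, B b -> s b = b) -> definable M B X ->
  X (s x) <-> X x.
Proof.
move=> sB [n [phi [b [Bb ->]]]] /=.
suff -> : scons (s x) b = s \o scons x b by exact: aut_sat.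
apply/funext => i; case: (unliftP ord0 i) => [j|] ->; rewrite /= ?scons0 //.
by rewrite !sconsS sB.
Qed.

End Automorphisms.

Lemma aut_invariantP B X : aut_invariant M B X <->
  forall s, automorphism M s -> (forall b, B b -> s b = b) -> forall x, X (s x) <-> X x.
Proof.
split=> invX s aut_s sB; have [[s' sK s'K] _ _] := aut_s.
  by move=> x; rewrite -{1}(invX s aut_s sB) (image_inj (can_inj sK)).
apply/seteqP; split=> [_ [x Xx <-]|x Xx]; first by rewrite invX.
by exists (s' x); rewrite ?s'K // -(invX s) ?s'K.
Qed.

Variable K : Type.
Hypotheses (limK : strong_limit K) (natK : small K [set: nat]).
Hypothesis homM : strongly_homogeneous K M.

(** Types are closed under complement, so [a] and [b] have the same type over [A]. The map fixing
    [A] and sending [a] to [b] is then partial elementary, and homogeneity extends it. *)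
Lemma aut_of_type A a b : small K A ->
  (forall X, definable M A X -> X a -> X b) ->
  exists s, [/\ automorphism M s, forall x, A x -> s x = x & s a = b].
Proof.
move=> sA tp_ab.
have tpE X : definable M A X -> X a <-> X b.
  move=> dX; split; first exact: tp_ab.
  by move=> Xb; apply: contrapT => /(tp_ab _ (definableC dX)).
pose f x := if x == a then b else x.
have sAa : small K (A `|` [set a]).
  by apply: small_setU => //; apply: small_subset (small_mem natK [:: a]) => x ->;
    rewrite /= inE.
have [|s [aut_s sE]] := homM sAa (f := f).
  move=> n phi c cA.
  (* The occurrences of [a] among the parameters become the free variable, so the type of [a] over
     [A] decides the formula. *)
  have dR : definable_rel M A (fun v : unit -> G =>
      sat M phi (assign v (fun i => if c i == a then inl tt else inr (c i)))).
    exists n, phi, (fun i => if c i == a then inl tt else inr (c i)); split=> // i x.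
    by case: eqP => // cia [<-]; case: (cA i).
  have /= := tpE _ (definable_of_rel dR).
  have -> : assign (fun=> a) (fun i => if c i == a then inl tt else inr (c i)) = c.
    by apply/funext => i; rewrite /assign; case: eqP.
  have -> // : assign (fun=> b) (fun i => if c i == a then inl tt else inr (c i)) = f \o c.
  by apply/funext => i; rewrite /assign /f /=; case: eqP.
exists s; split=> //; last by rewrite sE ?/f ?eqxx //; right.
move=> x Ax; rewrite sE; last by left.
(* If [a] lies in [A], the formula expressing equality with [a] is in its type and forces
   [b = a]. *)
rewrite /f; case: eqP => // xa; subst x.
have := definable_of_rel (definable_rel_const 0%N Ax (definable_rel_eq M A 0%N 1%N)).
by move=> /tp_ab/(_ erefl).
Qed.

End GroupDefinability.

(** * The number of definable sets *)

Section CountingFormulas.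
Variables (K : Type) (L : language) (T : Type) (M : structure L T) (A : set T).
Hypotheses (natK : small K [set: nat]) (limK : strong_limit K).
Hypotheses (fsymK : small K [set: Defs.fsym L]) (rsymK : small K [set: rsym L]).
Hypothesis sA : small K A.

Local Notation label := (nat + (Defs.fsym L + (rsym L + A)))%type.

(* A syntax tree is coded by the labels of its nodes, a node being given by
   the sequence of the child indices on the path from the root. *)
Fixpoint term_code n (t : term L n) (p : seq nat) : option label :=
  match t with
  | Var i => Some (inl (val i))
  | App f ts =>
    match p with
    | [::] => Some (inr (inl f))
    | j :: q => if insub j is Some i then term_code (ts i) q else None
    end
  end.

Fixpoint formula_code n (phi : formula L n) (p : seq nat) : option label :=
  match phi, p with
  | Eq _ _, [::] => Some (inl 0%N)
  | Eq s t, j :: q => if j == 0%N then term_code s q else term_code t q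
  | Rel r _, [::] => Some (inr (inr (inl r)))
  | Rel r ts, j :: q => if insub j is Some i then term_code (ts i) q else None
  | Bot, _ => Some (inl 1%N)
  | Imp _ _, [::] => Some (inl 2%N)
  | Imp phi psi, j :: q => if j == 0%N then formula_code phi q else formula_code psi q
  | All _, [::] => Some (inl 3%N)
  | All phi, _ :: q => formula_code phi q
  end.

Lemma term_code_inj n : injective (@term_code n).
Proof.
elim=> [i|f ts IH] [j|g us] e; have := congr1 (@^~ [::]) e => //= -[].
  by move=> /val_inj ->.
move=> efg; subst g; congr App; apply/funext => i; apply: IH; apply/funext => p.
by have := congr1 (@^~ (val i :: p)) e; rewrite /= valK.
Qed.

Lemma formula_code_inj n : injective (@formula_code n).
Proof.
elim=> {n} [n s t|n r ts|n|n phi IHp psi IHq|n phi IH];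
  case=> [s' t'|r' ts'||phi' psi'|phi'] e; have := congr1 (@^~ [::]) e => //=.
- move=> _; congr Eq; apply: term_code_inj; apply/funext => p.
    by have := congr1 (@^~ (0%N :: p)) e.
  by have := congr1 (@^~ (1%N :: p)) e.
- move=> [er]; subst r'; congr Rel; apply/funext => i; apply: term_code_inj.
  by apply/funext => p; have := congr1 (@^~ (val i :: p)) e; rewrite /= valK.
- move=> _; congr Imp; [apply: IHp|apply: IHq]; apply/funext => p.
    by have := congr1 (@^~ (0%N :: p)) e.
  by have := congr1 (@^~ (1%N :: p)) e.
- move=> _; congr All; apply: IH; apply/funext => p.
  by have := congr1 (@^~ (0%N :: p)) e.
Qed.

(** The empty path records the number of parameters, paths through 0 the formula, and paths starting
    with [j.+1] the parameter of index [j]. *)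
Definition definition_code n (phi : formula L n.+1) (b : 'I_n -> A) (p : seq nat) :
    option label :=
  match p with
  | [::] => Some (inl n)
  | 0 :: q => formula_code phi q
  | j.+1 :: q => if insub j is Some i then Some (inr (inr (inr (b i)))) else None
  end.

Lemma definition_code_inj n phi b m psi c :
  definition_code phi b = @definition_code m psi c ->
  [set x | sat M phi (scons x (fun i : 'I_n => set_val (b i)))] =
  [set x | sat M psi (scons x (fun i => set_val (c i)))].
Proof.
move=> e; have enm : Some (inl n : label) = Some (inl m) := congr1 (@^~ [::]) e.
have {}enm : n = m by case: enm.
subst m.
have -> : phi = psi.
  by apply: formula_code_inj; apply/funext => p; have := congr1 (@^~ (0%N :: p)) e.
have -> // : b = c.
apply/funext => i; have := congr1 (@^~ [:: (val i).+1]) e.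
by rewrite /= valK => -[].
Qed.

Lemma small_codes : small K [set: seq nat -> option label].
Proof.
have slabel : small K [set: label].
  by do 3?[apply: small_sum => //]; exact/small_set_type.
have := small_powerset limK (small_prod limK (small_countType natK (seq nat)) slabel).
(* A code is a partial function on paths and is determined by its graph. *)
apply: (@small_injective _ _ _ (fun f => [set pa | f pa.1 = Some pa.2])).
move=> f g /seteqP[fg gf]; apply/funext => p.
case fp: (f p) => [a|]; first by have /= -> := fg (p, a) fp.
by case gp: (g p) => [a|//]; have /= := gf (p, a) gp; rewrite fp.
Qed.

Lemma small_definable : small K (definable M A).
Proof.
pose D (c : seq nat -> option label) : set (set T) :=
  [set X | exists n (phi : formula L n.+1) (b : 'I_n -> A),
     c = definition_code phi b /\
     X = [set x | sat M phi (scons x (fun i => set_val (b i)))]].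
apply: small_subset (small_image (fun c => xget set0 (D c)) small_codes) => X.
move=> [n [phi [b [bA ->]]]].
pose b' i : A := SigSub (mem_set (bA i)).
exists (definition_code phi b') => //.
have DX : D (definition_code phi b') [set x | sat M phi (scons x b)].
  by exists n, phi, b'.
(* The set chosen by [xget] may come from another formula, but equal codes define equal sets. *)
by case: (xgetI set0 DX) => m [psi [c [/definition_code_inj /= -> ->]]].
Qed.

End CountingFormulas.

(** * Thick sets and subgroups of bounded index *)

Lemma powerset_not_injective (U : Type) (f : set U -> U) : ~ injective f.
Proof.
move=> injf; pose D := [set u | exists2 Y, f Y = u & ~ Y u].
have [DfD|nDfD] := pselect (D (f D)); last by apply: (nDfD); exists D.
by have [Y /injf ->] := DfD.
Qed.

(** The powerset of [G/H] serves as [I]: it is small for a strong limit, and by Cantor too large for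
    all entries to lie in distinct cosets. *)
Lemma bounded_index_pair K (G : groupType) (H : set G) :
  strong_limit K -> subgroup H -> bounded_index K H ->
  exists2 I : eqType, small K [set: I] &
    forall v : I -> G, exists i j, i != j /\ H ((v i)^-1 * v j).
Proof.
move=> limK gH bH; exists (set (range (left_coset H))).
  by apply: small_powerset => //; exact/small_set_type.
move=> v; apply: contrapT => nv.
pose c X : range (left_coset H) :=
  SigSub (mem_set (imageP (left_coset H) (I : [set: G] (v X)))).
apply: (@powerset_not_injective _ c) => X Y [/(left_coset_eq gH) HXY].
by apply: contrapT => /eqP XY; apply: nv; exists X, Y.
Qed.

Section Monster.
Variables (K : Type) (L : language) (G : groupType) (M0 : structure L G).
Local Notation M := (group_structure M0).
Hypothesis monM : monster K M.

Let natK : small K [set: nat]. Proof. by have [[]] := monM. Qed.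
Let limK : strong_limit K. Proof. by have [[]] := monM. Qed.
Let satM : saturated K M. Proof. by have [] := monM. Qed.
Let homM : strongly_homogeneous K M. Proof. by have [] := monM. Qed.

Lemma small_setU1 (B : set G) x : small K B -> small K (B `|` [set x]).
Proof.
move=> sB; apply: small_setU => //.
by apply: small_subset (small_mem natK [:: x]) => y ->; rewrite /= inE.
Qed.

(* Indexing by the subsets of G/H, two entries of a family whose quotients
   avoid every X must lie in the same coset of H. *)
Lemma bounded_index_avoid B (F : set (set G)) (H : set G) :
  small K B -> F `<=` definable M B -> F !=set0 ->
  (forall X x, F X -> X x -> X x^-1) ->
  (forall X Y, F X -> F Y -> exists2 Z, F Z & X `|` Y `<=` Z) ->
  (forall X, F X -> ~ thick X) ->
  subgroup H -> bounded_index K H ->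
  exists2 g, H g & forall X, F X -> ~ X g.
Proof.
move=> sB FB [X0 FX0] Finv Fdir Fnthick gH bH.
have [I sI HI] := bounded_index_pair limK gH bH.
pose R (s : seq I) X (v : I -> G) :=
  forall i, i \in s -> forall j, j \in s -> i != j -> ~ X ((v i)^-1 * v j).
have [v Rv] : exists v, forall R', [set R' | exists s X, F X /\ R' = R s X] R' -> R' v.
  apply: (saturated_rel satM limK 1 (B := B)) => //.
  - move=> _ [s [X [FX ->]]]; apply: definable_rel_all => i; apply: definable_rel_all => j.
    have dX := definable_rel_not (definable_rel_div i j (FB _ FX)).
    have [<-|_] := eqVneq i j.
      apply: definable_rel_ext (definable_rel_not (definable_rel_bot M B I)) => v.
      by split=> [_ /eqP|_ []].
    by apply: definable_rel_ext dX => v; split=> [//|]; apply.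
  - by exists (R [::] X0), [::], X0.
  - move=> _ _ [s [X [FX ->]]] [t [Y [FY ->]]]; have [Z FZ XYZ] := Fdir _ _ FX FY.
    exists (R (s ++ t) Z); first by exists (s ++ t), Z.
    move=> v Rv; split=> i si j sj ij Xij; apply: (Rv i _ j _ ij);
      rewrite ?mem_cat ?si ?sj ?orbT //; apply: XYZ; by [left|right].
  - move=> _ [s [X [FX ->]]].
    (* Each variable of [s] takes the entry of a long scattered sequence at its own position;
       symmetry of [X] handles pairs in reverse order. *)
    have [t st /(pairwiseP 1) Xt] :=
      not_thick_scattered (size s) (fun x => Finv X x FX) (Fnthick _ FX).
    exists (fun i => nth 1 t (index i s)) => i si j sj ij Xij.
    have lti : (index i s < size t)%N by apply: leq_trans st; rewrite index_mem.
    have ltj : (index j s < size t)%N by apply: leq_trans st; rewrite index_mem.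
    case: (ltngtP (index i s) (index j s)) => [lt|lt|e].
    + by have /asboolP := Xt _ _ lti ltj lt; apply.
    + have /asboolP := Xt _ _ ltj lti lt; apply.
      by have := Finv _ _ FX Xij; rewrite invgM invgK.
    + by move: ij; rewrite -(nth_index i si) e (nth_index i sj) eqxx.
have [i [j [ij Hij]]] := HI v.
exists ((v i)^-1 * v j) => // X FX.
apply: (Rv (R [:: i; j] X)) => //; first by exists [:: i; j], X.
  by rewrite inE eqxx.
by rewrite !inE eqxx orbT.
Qed.

Lemma bounded_index_thick B (H P : set G) : small K B -> definable M B P ->
  (forall x, P x -> P x^-1) -> subgroup H -> bounded_index K H -> H `<=` P -> thick P.
Proof.
move=> sB dP Pinv gH bH HP; apply: contrapT => nP.
have [|||||g Hg /(_ P erefl)] := @bounded_index_avoid B [set P] H sB _ _ _ _ _ gH bH.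
- by move=> _ ->.
- by exists P.
- by move=> _ x ->; exact: Pinv.
- by move=> _ _ -> ->; exists P => //; rewrite setUid.
- by move=> _ ->.
by apply; exact: HP.
Qed.

(** * Thick core, hull and products of thick sets *)

Variable A : set G.
Hypothesis sA : small K A.

(** This is [Theta]. *)
Definition thick_core : set G :=
  [set x | forall Q, definable M A Q -> thick Q -> Q x].

Definition hull (H : set G) : set G :=
  [set x | forall P, definable M A P -> H `<=` P -> P x].

(** This is [R]. *)
Definition thick_products (H : set G) : set G :=
  \bigcap_(PQ in [set PQ : set G * set G |
      [/\ definable M A PQ.1, thick PQ.1, definable M A PQ.2, thick PQ.2 &
          H `|` PQ.2 `<=` PQ.1]]) set_mul PQ.1 PQ.2.

Lemma definable_sym X : definable M A X -> definable M A [set x | X x /\ X x^-1].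
Proof. by move=> dX; apply: definableI => //; exact: definable_setV. Qed.

(** The symmetric definable sets missing [a] are not thick, so some [g] in [H] avoids them all. Then
    [g] or its inverse has the type of [a], and an automorphism carries it to [a] within [H]. *)
Lemma thick_core_sub (H : set G) : subgroup H -> aut_invariant M A H ->
  bounded_index K H -> thick_core `<=` H.
Proof.
move=> gH /aut_invariantP iH bH a Ta.
pose F := [set X | [/\ definable M A X, forall x, X x -> X x^-1 & ~ X a]].
have [|||||g Hg Fg] := @bounded_index_avoid A F H sA _ _ _ _ _ gH bH.
- by move=> X [].
- by exists set0; split=> //; exact: definable0.
- by move=> X x [_ + _]; apply.
- move=> X Y [dX Xinv nX] [dY Yinv nY]; exists (X `|` Y) => //; split.
  + exact: definableU.
  + by move=> x [/Xinv|/Yinv]; [left|right].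
  + by case.
- by move=> X [dX _ nX] tX; apply: nX; exact: Ta.
have [g' Hg' tpg] : exists2 g', H g' & forall X, definable M A X -> X g' -> X a.
  apply: contrapT => ng.
  have [X [dX Xg nXa]] : exists X, [/\ definable M A X, X g & ~ X a].
    apply: contrapT => nX; apply: ng; exists g => // X dX Xg.
    by apply: contrapT => nXa; apply: nX; exists X.
  have [Y [dY Yg nYa]] : exists Y, [/\ definable M A Y, Y g^-1 & ~ Y a].
    apply: contrapT => nY; apply: ng; exists g^-1; first exact: subgroupV.
    by move=> Y dY Yg; apply: contrapT => nYa; apply: nY; exists Y.
  (* If both types differ from that of [a], the symmetrization of [Z] misses [a] but contains
     [g]. *)
  pose Z := X `&` [set x | Y x^-1].
  have dZ : definable M A Z by apply: definableI => //; exact: definable_setV.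
  apply: (Fg (Z `|` [set x | Z x^-1])); last by left.
  split.
  - by apply: definableU => //; exact: definable_setV.
  - by move=> x [Zx|Zx]; [right; rewrite /= invgK|left].
  - by case=> -[] //= _; rewrite invgK.
have [s [aut_s sE <-]] := aut_of_type limK natK homM sA tpg.
by rewrite (iH _ aut_s sE).
Qed.

(** The first factors of [x] with respect to the pairs of [F] form a directed family of sets
    definable over [B] and [x], so saturation yields one factorization good for all pairs. *)
Lemma saturated_set_mul B (F : set (set G * set G)) x : small K B ->
  (forall PQ, F PQ -> definable M B PQ.1 /\ definable M B PQ.2) -> F !=set0 ->
  (forall PQ PQ', F PQ -> F PQ' ->
     exists2 R, F R & R.1 `<=` PQ.1 `&` PQ'.1 /\ R.2 `<=` PQ.2 `&` PQ'.2) ->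
  (forall PQ, F PQ -> set_mul PQ.1 PQ.2 x) ->
  exists y, forall PQ, F PQ -> PQ.1 y /\ PQ.2 (y^-1 * x).
Proof.
move=> sB FB [PQ0 FPQ0] Fdir Fx.
pose Z (PQ : set G * set G) := PQ.1 `&` [set y | PQ.2 (y^-1 * x)].
have [y Fy] : \bigcap_(Y in Z @` F) Y !=set0.
  apply: (saturated_directed satM (B := B `|` [set x])).
  - exact: small_setU1.
  - move=> _ [PQ /FB[dP dQ] <-].
    have BBx : B `<=` B `|` [set x] by left.
    apply: definableI; first exact: definable_sub dP.
    by apply: definable_div; [right|exact: definable_sub dQ].
  - by exists (Z PQ0), PQ0.
  - move=> _ _ [PQ FPQ <-] [PQ' FPQ' <-].
    have [R FR [R1 R2]] := Fdir _ _ FPQ FPQ'.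
    exists (Z R); first by exists R.
    by move=> y [/R1[P1 P2] /R2[Q1 Q2]].
  - move=> _ [PQ FPQ <-]; have [y Py [z Qz yz]] := Fx _ FPQ.
    by exists y; split=> //; rewrite /= -yz mulKg.
exists y => PQ FPQ; have Zy : Z PQ y by apply: Fy; exists PQ.
exact: Zy.
Qed.

Lemma thick_products_hull (H : set G) x : subgroup H -> bounded_index K H ->
  thick_products H x -> exists2 y, hull H y & thick_core (y^-1 * x).
Proof.
move=> gH bH Rx.
pose F : set (set G * set G) :=
  [set PQ | [/\ definable M A PQ.1, H `<=` PQ.1, definable M A PQ.2 & thick PQ.2]].
have [||||y Fy] := @saturated_set_mul A F x sA.
- by move=> PQ [].
- by exists (setT, setT); split=> //; [exact: definableT|exact: definableT|exact: thickT].
- move=> [P Q] [P' Q'] [/= dP HP dQ tQ] [/= dP' HP' dQ' tQ'].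
  exists (P `&` P', Q `&` Q'); last by split.
  split => /=.
  + exact: definableI.
  + by move=> h Hh; split; [apply: HP|apply: HP'].
  + exact: definableI.
  + exact: thickI.
(* The pair is shrunk to an admissible one: the symmetric part of [PQ.1] is thick because it
   contains [H], and it contains its intersection with [PQ.2]. *)
- move=> PQ [dP HP dQ tQ]; pose P := [set z | PQ.1 z /\ PQ.1 z^-1].
  have dP' : definable M A P by exact: definable_sym.
  have HP' : H `<=` P by move=> h Hh; split; apply: HP => //; exact: subgroupV.
  have tP' : thick P.
    by apply: (bounded_index_thick sA dP' _ gH bH HP') => z [? ?]; rewrite /P /= invgK.
  have [y [Py _] [z [Qz _] <-]] : set_mul P (PQ.2 `&` P) x.
    apply: (Rx (P, PQ.2 `&` P)).
    split=> //=; [exact: definableI|exact: thickI|by move=> z [/HP'|[]]].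
  by exists y => //; exists z.
exists y => [P dP HP|Q dQ tQ].
  by case: (Fy (P, setT)) => //; split=> //; [exact: definableT|exact: thickT].
by case: (Fy (setT, Q)) => //; split=> //; exact: definableT.
Qed.

Lemma hull_sub_set_mul (H Q : set G) : aut_invariant M A H ->
  definable M A Q -> thick Q -> hull H `<=` set_mul H Q.
Proof.
move=> /aut_invariantP iH dQ tQ y Hy.
have [w [wH Hw]] := thick_cover H tQ.
pose D := [set x | exists2 b, b \in w & Q (b^-1 * x)].
have AAw : A `<=` A `|` [set` w] by left.
have dD : definable M (A `|` [set` w]) D.
  by apply: definable_lcosets => [b bw|]; [right|exact: definable_sub dQ].
pose F := [set X `&` D | X in [set X | definable M A X /\ X y]].
have [y' Fy'] : \bigcap_(Y in F) Y !=set0.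
  apply: (saturated_directed satM (B := A `|` [set` w])).
  - by apply: small_setU => //; exact: (small_mem natK).
  - by move=> _ [X [dX _] <-]; apply: definableI => //; exact: definable_sub dX.
  - by exists (setT `&` D), setT => //; split=> //; exact: definableT.
  - move=> _ _ [X [dX Xy] <-] [Y [dY Yy] <-]; exists (X `&` Y `&` D).
      by exists (X `&` Y) => //; split=> //; exact: definableI.
    by move=> z [[Xz Yz] Dz].
  (* If [X] missed [D], its complement would contain [H] and hence [y]. *)
  - move=> _ [X [dX Xy] <-]; apply: contrapT => XD0.
    apply: (Hy (~` X)) => //; first exact: definableC.
    by move=> h /Hw Dh Xh; apply: XD0; exists h.
have [s [aut_s sE sy]] : exists s, [/\ automorphism M s, forall x, A x -> s x = x & s y = y'].
  apply: (aut_of_type limK natK homM sA) => X dX Xy.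
  by have [] : (X `&` D) y' by apply: Fy'; exists X.
have [_ [b bw Qb]] : (setT `&` D) y'.
  by apply: Fy'; exists setT => //; split=> //; exact: definableT.
have [[s' _ s'K] _ _] := aut_s.
(* The inverse automorphism carries the translate [b Q] containing [y'] to the translate [s' b Q]
   containing [y]. *)
exists (s' b); first by rewrite -(iH s aut_s sE) s'K; exact: wH.
exists ((s' b)^-1 * y); last by rewrite mulVKg.
rewrite -(aut_definable aut_s _ sE dQ).
suff -> : s ((s' b)^-1 * y) = b^-1 * y' by [].
by rewrite -sy -{2}[y](mulVKg (s' b)) (aut_mul aut_s (s' b)) s'K mulKg.
Qed.

Lemma set_mul_normal (H Q : set G) x t : subgroup H -> normal_set H ->
  set_mul H Q x -> H t -> set_mul H Q (x * t).
Proof.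
move=> gH nH [h Hh [q Qq <-]] Ht.
(* Here [h q t] is rewritten as [h (q t q^-1) q]. *)
exists (h * t ^ q^-1); first by apply: subgroupM => //; exact: nH.
by exists q => //; rewrite conjgE invgK -!mulgA mulVg mulg1.
Qed.

Lemma thick_productsP (H : set G) : subgroup H -> normal_set H ->
  aut_invariant M A H -> bounded_index K H ->
  forall x, thick_products H x <->
    forall Q, definable M A Q -> thick Q -> set_mul H Q x.
Proof.
move=> gH nH iH bH x; split=> [Rx Q dQ tQ|Hx].
  have [y Hy Ty] := thick_products_hull gH bH Rx.
  rewrite -[x](mulVKg y); apply: set_mul_normal => //.
    exact: hull_sub_set_mul Hy.
  exact: thick_core_sub Ty.
move=> [P Q] [/= dP tP dQ tQ HQP]; have [h Hh [q Qq <-]] := Hx Q dQ tQ.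
by exists h; [apply: HQP; left|exists q].
Qed.

Lemma thick_products_type_definable H : type_definable M A (thick_products H).
Proof.
exists [set set_mul PQ.1 PQ.2 | PQ in [set PQ : set G * set G |
    [/\ definable M A PQ.1, thick PQ.1, definable M A PQ.2, thick PQ.2 &
        H `|` PQ.2 `<=` PQ.1]]]; split.
  by move=> _ [PQ [dP _ dQ _ _] <-]; exact: definable_set_mul.
apply/seteqP; split=> x Rx; first by move=> _ [PQ FPQ <-]; exact: Rx.
by move=> PQ FPQ; apply: Rx; exists PQ.
Qed.

(** * Minimality of the intersection of products *)

Section NormalSubgroup.
Variable H : set G.
Hypotheses (gH : subgroup H) (nH : normal_set H) (iH : aut_invariant M A H).
Hypothesis bH : bounded_index K H.

Lemma sub_thick_products : H `<=` thick_products H.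
Proof.
move=> h Hh; apply/thick_productsP => // Q dQ tQ.
by exists h => //; exists 1; [exact: thick1|rewrite mulg1].
Qed.

Lemma thick_productsMr x t : thick_products H x -> H t -> thick_products H (x * t).
Proof.
move=> /(thick_productsP gH nH iH bH) Hx Ht; apply/thick_productsP => // Q dQ tQ.
by apply: set_mul_normal => //; exact: Hx.
Qed.

(** [x] lies in [H Q], hence in [P Q] for each definable [P] containing [F]; a common factorization
    writes [x] as a member of [F] times one of [thick_core]. The set [B] makes room for the
    parameters of a model or of a translate. *)
Lemma thick_products_min B (F : set G) : small K B -> A `<=` B ->
  type_definable M B F -> H `<=` F ->
  (forall x t, F x -> thick_core t -> F (x * t)) -> thick_products H `<=` F.
Proof.
move=> sB AB [FF [FFB FE]] HF FT x /(thick_productsP gH nH iH bH) Hx.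
pose E : set (set G * set G) :=
  [set PQ | [/\ definable M B PQ.1, F `<=` PQ.1, definable M A PQ.2 & thick PQ.2]].
have [||||y Ey] := @saturated_set_mul B E x sB.
- by move=> PQ [dP _ dQ _]; split=> //; exact: definable_sub dQ.
- by exists (setT, setT); split=> //; [exact: definableT|exact: definableT|exact: thickT].
- move=> [P Q] [P' Q'] [/= dP FP dQ tQ] [/= dP' FP' dQ' tQ'].
  exists (P `&` P', Q `&` Q'); last by split.
  split => /=.
  + exact: definableI.
  + by move=> h Fh; split; [apply: FP|apply: FP'].
  + exact: definableI.
  + exact: thickI.
- move=> PQ [dP FP dQ tQ]; have [h Hh [q Qq <-]] := Hx _ dQ tQ.
  by exists h; [exact/FP/HF|exists q].
rewrite -[x](mulVKg y); apply: FT => [|Q dQ tQ].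
  rewrite FE => Y FFY; case: (Ey (Y, setT)) => //; split=> //=; first exact: FFB.
  - by rewrite FE => z; apply.
  - exact: definableT.
  - exact: thickT.
by case: (Ey (setT, Q)) => //; split=> //; exact: definableT.
Qed.

End NormalSubgroup.

Lemma bounded_index_sub (H H' : set G) : subgroup H -> subgroup H' ->
  H `<=` H' -> bounded_index K H -> bounded_index K H'.
Proof.
move=> gH gH' HH'; apply: small_card_le.
apply: (@card_le_of_factor _ _ _ (left_coset H) (left_coset H')) => x y /(left_coset_eq gH) Hxy.
exact/(left_coset_eq gH')/HH'.
Qed.

Lemma type_definable_preimage B B' (f : G -> G) (F : set G) :
  (forall Y, definable M B Y -> definable M B' (f @^-1` Y)) ->
  type_definable M B F -> type_definable M B' (f @^-1` F).
Proof.
move=> fB [FF [FFB ->]]; exists [set f @^-1` Y | Y in FF]; split.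
  by move=> _ [Y /FFB dY <-]; exact: fB.
apply/seteqP; split=> x Fx; first by move=> _ [Y FFY <-]; exact: Fx.
by move=> Y FFY; apply: (Fx (f @^-1` Y)); exists Y.
Qed.

Lemma type_definable_sub B B' (F : set G) : B `<=` B' ->
  type_definable M B F -> type_definable M B' F.
Proof.
by move=> BB' [FF [FFB ->]]; exists FF; split=> // Y /FFB; exact: definable_sub.
Qed.

Lemma type_definable_aut_invariant B (F : set G) :
  type_definable M B F -> aut_invariant M B F.
Proof.
move=> [FF [FFB ->]]; apply/aut_invariantP => s aut_s sB x.
by split=> Fx Y FFY; have := Fx Y FFY; rewrite (aut_definable aut_s _ sB (FFB _ FFY)).
Qed.

Lemma hull_type_definable (F : set G) : type_definable M A F -> hull F `<=` F.
Proof.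
move=> [FF [FFA ->]] x Fx Y FFY; apply: Fx; first exact: FFA.
by move=> y; apply.
Qed.

Section SubgroupOfThickProducts.
Variable H : set G.
Hypotheses (gH : subgroup H) (nH : normal_set H) (iH : aut_invariant M A H).
Hypothesis bH : bounded_index K H.

(* The translates and the inverse of [thick_products H] are again
   type-definable, closed under right multiplication by H, and contain H. *)
Lemma thick_products_subgroup : subgroup (thick_products H).
Proof.
have RM x y : thick_products H x -> thick_products H y -> thick_products H (x * y).
  move=> Rx; apply: (thick_products_min gH nH iH bH (B := A `|` [set x^-1])
    (F := [set y | thick_products H (x * y)])).
  - exact: small_setU1.
  - by left.
  - apply: type_definable_preimage (thick_products_type_definable H) => Y dY.
    have := @definable_lcoset _ _ M0 (A `|` [set x^-1]) Y x^-1 (or_intror erefl).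
    rewrite invgK; apply; apply: definable_sub dY; by left.
  - by move=> h Hh; exact: thick_productsMr.
  - move=> z t Rxz Tt; rewrite /= mulgA; apply: thick_productsMr => //.
    exact: thick_core_sub Tt.
apply: subgroupP => //; first by apply: sub_thick_products => //; exact: subgroup1.
apply: (thick_products_min gH nH iH bH (B := A) (F := [set x | thick_products H x^-1])) => //.
- apply: type_definable_preimage (thick_products_type_definable H) => Y dY.
  exact: definable_setV.
- by move=> h Hh; apply: sub_thick_products => //; exact: subgroupV.
(* Inversion moves [t] to the left, where closure under products absorbs it. *)
- move=> x t Rx Tt; rewrite /= invgM; apply: RM => //; apply: sub_thick_products => //.
  by apply: subgroupV => //; exact: thick_core_sub Tt.
Qed.

End SubgroupOfThickProducts.

(** * Bounded index and normality of [Ginfty] *)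

Lemma aut_invariant_Ginfty : aut_invariant M A (Ginfty K M A).
Proof.
apply/aut_invariantP => s aut_s sA' x; split=> Nx H HH; have [_ /aut_invariantP iH _] := HH.
  by rewrite -(iH s aut_s sA'); exact: Nx.
by rewrite (iH s aut_s sA'); exact: Nx.
Qed.

Lemma thick_core_Ginfty : thick_core `<=` Ginfty K M A.
Proof. by move=> x Tx H [gH iH bH]; exact: thick_core_sub Tx. Qed.

Lemma thick_core_mul x :
  (forall Q, definable M A Q -> thick Q -> set_mul Q Q x) ->
  exists2 y, thick_core y & thick_core (y^-1 * x).
Proof.
move=> Qx.
pose F : set (set G * set G) :=
  [set PQ | [/\ definable M A PQ.1, thick PQ.1 & PQ.2 = PQ.1]].
have [||||y Fy] := @saturated_set_mul A F x sA.
- by move=> PQ [dP _ ->].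
- by exists (setT, setT); split=> //; [exact: definableT|exact: thickT].
- move=> [P _] [P' _] [/= dP tP ->] [/= dP' tP' ->].
  exists (P `&` P', P `&` P'); last by split.
  by split=> //=; [exact: definableI|exact: thickI].
- by move=> PQ [dP tP ->]; exact: Qx.
by exists y => Q dQ tQ; have [] := Fy (Q, Q) (And3 dQ tQ erefl).
Qed.

(* x and y are congruent modulo the thick core squared as soon as they lie in
   the same translates bQ, where Q is thick and b ranges over finitely many
   elements depending on Q. *)
Lemma bounded_index_Ginfty : bounded_index K (Ginfty K M A).
Proof.
have [[_ fsymK rsymK _] _ _] := monM.
pose T := [set Q | definable M A Q /\ thick Q].
have sT : small K [set: T].
  apply/small_set_type; apply: small_subset (small_definable M natK limK fsymK rsymK sA).
  by move=> Q [].
have /choice[c cP] (Q : T) : exists s : seq G, forall x : G,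
    exists2 b, b \in s & set_val Q (b^-1 * x).
  have [_ tQ] := set_valP Q; have [s [_ sP]] := thick_cover setT tQ.
  by exists s => x; exact: sP.
(* The code of [x] lists all translates, over all [Q], that contain [x]; there are few codes since
   there are few definable sets. *)
pose code x : set (T * nat) :=
  [set p | (p.2 < size (c p.1))%N /\ set_val p.1 ((nth 1 (c p.1) p.2)^-1 * x)].
have := small_card_le (card_leT (range code)) (small_powerset limK (small_prod limK sT natK)).
apply: small_card_le; apply: card_le_of_factor => x y /seteqP[xy _].
apply/(left_coset_eq (subgroup_Ginfty K M A)).
have [|z Tz Tzxy] := @thick_core_mul (x^-1 * y).
  move=> Q dQ tQ; pose Q' : T := SigSub (mem_set (conj dQ tQ)).
  have [b bc Qbx] := cP Q' x.
  have [|_] := xy (Q', index b (c Q')); first by split; rewrite /= ?index_mem ?nth_index.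
  rewrite /= nth_index // => Qby.
  (* With [x] and [y] both in [b Q], the quotient factors through [b] into two members of the
     symmetric set [Q]. *)
  exists (b^-1 * x)^-1; first exact: thick_inv.
  by exists (b^-1 * y) => //; rewrite invgM invgK -mulgA mulVKg.
rewrite -[x^-1 * y](mulVKg z).
by apply: (subgroupM (subgroup_Ginfty K M A)); exact: thick_core_Ginfty.
Qed.

(** The normal core [C] of [N] is again an invariant subgroup of bounded index, so [N] is contained
    in it by minimality. *)
Lemma normal_Ginfty : normal_set (Ginfty K M A).
Proof.
set N := Ginfty K M A.
have gN : subgroup N by exact: subgroup_Ginfty.
pose C := [set x | forall g, N (x ^ g)].
suff NC : N `<=` C by move=> g x /NC.
move=> x Nx; apply: (Nx C).
have gC : subgroup C.
  apply: subgroupP => [g|y z Cy Cz g|y Cy g].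
  - by rewrite conj1g; exact: (subgroup1 gN).
  - by rewrite conjMg; exact: (subgroupM gN).
  - by rewrite conjVg; exact: (subgroupV gN).
split=> //.
  apply/aut_invariantP => s aut_s sA' y.
  have /aut_invariantP/(_ s aut_s sA') iN := aut_invariant_Ginfty.
  have [[s' _ s'K] _ _] := aut_s.
  have sJ z g : s (z ^ g) = s z ^ s g.
    by rewrite !conjgE; apply: (mulgI (s g)); rewrite -!(aut_mul aut_s) !mulVKg.
  split=> Cy g; first by rewrite /N -iN sJ; exact: Cy.
  by rewrite -[g]s'K -sJ /N iN; exact: Cy.
pose D := range (left_coset N).
have sD : small K [set: D] by apply/small_set_type; exact: bounded_index_Ginfty.
(* [e y] is the graph of left multiplication by [y] on [G/N]; equal graphs mean equal cosets of [C],
   the kernel of this action. *)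
pose e y : set (D * D) :=
  [set p | exists g, set_val p.1 = left_coset N g /\ set_val p.2 = left_coset N (y * g)].
have := small_card_le (card_leT (range e)) (small_powerset limK (small_prod limK sD sD)).
apply: small_card_le; apply: card_le_of_factor => y z /seteqP[yz _].
apply/(left_coset_eq gC) => g.
pose d h : D := SigSub (mem_set (imageP (left_coset N) (I : [set: G] h))).
have [|h [/= /(left_coset_eq gN) gh /(left_coset_eq gN) ygzh]] := yz (d g, d (y * g)).
  by exists g.
have := subgroupM gN ygzh (subgroupV gN gh).
by rewrite conjgE !invgM invgK !mulgA mulgK.
Qed.

(** * The two equalities *)

Lemma G00E : G00 K M A = thick_products (Ginfty K M A).
Proof.
have gN := subgroup_Ginfty K M A.
have [nN iN bN] := And3 normal_Ginfty aut_invariant_Ginfty bounded_index_Ginfty.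
apply/seteqP; split=> x.
  apply; split.
  - exact: thick_products_subgroup.
  - exact: thick_products_type_definable.
  - have NR := sub_thick_products gN nN iN bN.
    exact: (bounded_index_sub gN (thick_products_subgroup gN nN iN bN) NR bN).
move=> Rx S [gS dS bS].
have iS := type_definable_aut_invariant dS.
have NS : Ginfty K M A `<=` S by move=> y; apply.
(* [S] need not be normal, so [x] is factored through [hull S], which equals [S], and [thick_core];
   pairs admissible for [S] are admissible for [Ginfty]. *)
have RSx : thick_products S x.
  move=> PQ [dP tP dQ tQ SQP]; apply: Rx; split=> //.
  by apply: subset_trans SQP; exact: setSU.
have [y Sy Ty] := thick_products_hull gS bS RSx.
rewrite -[x](mulVKg y); apply: subgroupM => //; first exact: hull_type_definable.
exact: thick_core_sub Ty.
Qed.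

Lemma closure_coset_map (D H : set G) : A `<=` D -> small K D ->
  subgroup H -> normal_set H -> aut_invariant M A H -> bounded_index K H ->
  coset_map K M A D @^-1` closure (coset_map K M A D @` H) = thick_products H.
Proof.
move=> AD sD gH nH iH bH; rewrite closureE; apply/seteqP; split=> x.
  have NH : Ginfty K M A `<=` H by move=> y; apply; split.
  (* [thick_products H] is a union of cosets of [Ginfty], so its image is closed. *)
  have iR : coset_map K M A D @^-1` (coset_map K M A D @` thick_products H) = thick_products H.
    apply/seteqP; split=> [y [r Rr /coset_mapE ry]|y Ry]; last by exists y.
    by rewrite -[y](mulVKg r); apply: thick_productsMr => //; exact: NH.
  move=> /(_ (coset_map K M A D @` thick_products H))[].
    split; last by apply: image_subset; exact: sub_thick_products.
    apply/logic_closedE; rewrite iR.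
    exact/(type_definable_sub AD)/thick_products_type_definable.
  by move=> r Rr rx; rewrite -iR; exists r.
move=> Rx C [/logic_closedE dC HC].
(* The preimage of a closed set is stable under [thick_core] because [Ginfty] contains
   [thick_core]. *)
apply: (thick_products_min gH nH iH bH sD AD dC) Rx => [h Hh|y t Cy Tt].
  by apply: HC; exists h.
rewrite /= (_ : coset_map K M A D (y * t) = coset_map K M A D y) //.
apply/esym/coset_mapE; rewrite mulKg; exact: thick_core_Ginfty.
Qed.

End Monster.

Theorem theorem3p4 (K : Type) (L : language) (G : groupType)
    (M0 : structure L G) (M := group_structure M0) (A : set G) :
  monster K M -> small K A ->
  (forall G' : set G,
     small K G' -> elementary_substructure M G' -> A `<=` G' ->
   forall H : set G,
     subgroup H -> normal_set H -> aut_invariant M A H -> bounded_index K H ->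
     let i := coset_map K M A G' in
     i @^-1` closure (i @` H) =
     \bigcap_(PQ in [set PQ : set G * set G |
         [/\ definable M A PQ.1, thick PQ.1, definable M A PQ.2, thick PQ.2 &
             H `|` PQ.2 `<=` PQ.1]]) set_mul PQ.1 PQ.2)
  /\
  G00 K M A =
  \bigcap_(PQ in [set PQ : set G * set G |
      [/\ definable M A PQ.1, thick PQ.1, definable M A PQ.2, thick PQ.2 &
          Ginfty K M A `|` PQ.2 `<=` PQ.1]]) set_mul PQ.1 PQ.2.
Proof.
move=> monM sA; split; last exact: G00E.
by move=> G' sG' _ AG' H gH nH iH bH /=; exact: closure_coset_map.
Qed.
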